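(* Fix an integer $m\geq 2$. Then, up to isomorphism, there are only finitely many non-complete coconnected non-geometric distance-regular graphs with smallest eigenvalue at least $-m$ and intersection number $c_2$ at least $2$.
   Context: All graphs are finite, undirected and simple. A connected graph $\Gamma$ with diameter $D$ is distance-regular if there are integers $b_i,c_i$ ($0\le i\le D$) such that for any vertices $x,y$ with $d(x,y)=i$, exactly $c_i$ neighbours of $y$ are at distance $i-1$ from $x$ and exactly $b_i$ neighbours of $y$ are at distance $i+1$ from $x$; it is then regular of valency $k=b_0$, and $a_i:=k-b_i-c_i$. The smallest eigenvalue $\theta_D$ is the smallest eigenvalue of the adjacency matrix. A clique is a set of pairwise adjacent vertices. A Delsarte clique in a distance-regular graph with valency $k$, diameter $D\ge 2$ and smallest eigenvalue $\theta_D$ is a clique with exactly $1+\frac{k}{-\theta_D}$ vertices. A non-complete distance-regular graph is geometric if there is a set $\mathcal C$ of Delsarte cliques such that every edge lies in exactly one member of $\mathcal C$. A graph is coconnected if its complement is connected. *)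

(* Defs.v *)
From HB Require Import structures.
From mathcomp Require Import all_boot all_order all_algebra.
From mathcomp Require Import algC.
Set Implicit Arguments. Unset Strict Implicit. Unset Printing Implicit Defensive.
Import Order.TTheory GRing.Theory Num.Theory.

Section Graphs.
Variable T : finType.
Variable e : rel T.

Definition simple_graph := symmetric e /\ irreflexive e.

Fixpoint within (n : nat) (x y : T) : bool :=
  match n with
  | 0 => x == y
  | n'.+1 => within n' x y || [exists z, within n' x z && e z y]
  end.

(* graph distance (meaningful for connected graphs: then it is < #|T|) *)
Definition gdist (x y : T) : nat :=
  index true [seq within i x y | i <- iota 0 #|T|].

Definition gconnected := forall x y : T, connect e x y.

Definition nbhd (x : T) : {set T} := [set z | e x z].
Definition deg (x : T) : nat := #|nbhd x|.

Definition c_num (x y : T) : nat :=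
  #|[set z | e y z & gdist x z == (gdist x y).-1]|.
Definition b_num (x y : T) : nat :=
  #|[set z | e y z & gdist x z == (gdist x y).+1]|.

Definition distance_regular :=
  gconnected /\
  forall x y x' y' : T, gdist x y = gdist x' y' ->
    c_num x y = c_num x' y' /\ b_num x y = b_num x' y'.

Definition complete_graph := forall x y : T, x != y -> e x y.

Definition coconnected :=
  forall x y : T, connect (fun u v => (u != v) && ~~ e u v) x y.

Local Open Scope ring_scope.
Definition adjmx : 'M[algC]_#|T| :=
  \matrix_(i, j) (e (enum_val i) (enum_val j))%:R.

Definition smallest_eigenvalue (th : algC) :=
  eigenvalue adjmx th /\ forall a, eigenvalue adjmx a -> th <= a.

Definition clique (C : {set T}) :=
  forall x y, x \in C -> y \in C -> x != y -> e x y.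

Definition delsarte_clique (th : algC) (C : {set T}) :=
  clique C /\ forall x : T, (#|C|%:R : algC) = 1 + (deg x)%:R / (- th).

Definition geometric :=
  ~ complete_graph /\
  exists th, smallest_eigenvalue th /\
  exists CC : {set {set T}},
    (forall C, C \in CC -> delsarte_clique th C) /\
    (forall x y, e x y -> #|[set C in CC | (x \in C) && (y \in C)]| = 1).

End Graphs.

Definition graph_iso (T : finType) (e : rel T) (n : nat) (r : rel 'I_n) :=
  exists f : T -> 'I_n, bijective f /\ forall x y, e x y = r (f x) (f y).

(* Main.v *)
(** Test vectors for [A + m I >= 0] show that a vertex has at most [m^2] pairwise
    non-adjacent neighbours, and that a vertex and [m^2 + 1] of its non-neighbours cannot
    all be joined to one large clique.
    If [c_2] is huge, Ramsey's theorem gives a large clique in every common neighbourhood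
    of two vertices at distance 2, and the two facts above leave room for boundedly many
    vertices at distance 2 from a given one.  Then the diameter is 2, and the complement,
    being connected of diameter 2 and bounded valency, is bounded.
    If [c_2] is bounded and the valency is huge, every edge lies in a unique large maximal
    clique, every vertex lies on the same number [s] of these lines, and there are fewer lines
    than vertices, so that [A + s I = N N^T] is singular.  A nonzero matrix [E] whose entries
    depend only on the distance and with [E (A + s I) = 0] satisfies [E N = 0], which forces
    all lines to have the same size, namely [1 + k / s]: the graph is geometric.
    If the valency is bounded, so is the diameter, by an argument in the style of Ivanov:
    for [i >= 2], the columns [i .. 2 i] of the intersection array cannot all be equal when
    column [i - 1] is different, and columns 1 and 2 differ because [c_2 >= 2]. *)
Require Import Defs.
From mathcomp Require Import all_boot all_order all_algebra.
From mathcomp Require Import algC.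
From mathcomp Require Import zify ring.
Import Order.TTheory GRing.Theory Num.Theory.
Set Implicit Arguments. Unset Strict Implicit. Unset Printing Implicit Defensive.

(** * Graph distance *)

Section Distance.
Variables (T : finType) (e : rel T).
Hypothesis e_sym : symmetric e.
Hypothesis e_conn : gconnected e.
Notation d := (gdist e).

Lemma within_path n x y : reflect (exists2 p, path e x p & last x p = y /\ size p <= n) (within e n x y).
Proof.
elim: n y => [|n IH] y /=.
  apply: (iffP eqP) => [->|[p _ [<-]]]; first by exists [::].
  by rewrite leqn0 => /nilP ->.
apply: (iffP orP) => [[/IH[p pP [pl ps]]|/existsP[z /andP[/IH[p pP [pl ps]] ezy]]]|].
- by exists p => //; split=> //; apply: leqW.
- exists (rcons p y); first by rewrite rcons_path pP pl.
  by rewrite last_rcons size_rcons.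
case; case/lastP=> [|p z] pP [pl ps].
  by left; apply/IH; exists [::].
right; apply/existsP; exists (last x p); move: pP pl ps.
rewrite rcons_path last_rcons size_rcons ltnS => /andP[pP ez] <- ps.
by rewrite ez andbT; apply/IH; exists p.
Qed.

Lemma within_mono n n' x y : n <= n' -> within e n x y -> within e n' x y.
Proof.
move=> le /within_path[p pP [pl ps]]; apply/within_path; exists p => //.
by split=> //; apply: leq_trans le.
Qed.

Lemma within_card x y : within e #|T|.-1 x y.
Proof.
have /connectP[p pP ->] := e_conn x y.
case/shortenP: pP => q qP qu _; apply/within_path; exists q => //; split=> //.
by have := max_card (mem (x :: q)); rewrite (card_uniqP qu) /=; case: #|T|.
Qed.

(** [gdist] is the position of the first [true] in a list of length [#|T|]. By connectedness a
    [true] does occur, at position [#|T|.-1] at the latest, since a walk shortens to one without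
    repeated vertices. *)
Lemma gdistP n x y : (d x y <= n) = within e n x y.
Proof.
have T0 : 0 < #|T| by apply/card_gt0P; exists x.
set s := [seq within e i x y | i <- iota 0 #|T|].
have ss : size s = #|T| by rewrite size_map size_iota.
have hs : true \in s.
  apply/mapP; exists #|T|.-1; last by rewrite within_card.
  by rewrite mem_iota leq0n add0n ltn_predL.
have ltd : d x y < #|T| by rewrite -ss index_mem.
have nd : within e (d x y) x y.
  have := nth_index false hs; rewrite (nth_map 0); last by rewrite size_iota.
  by rewrite nth_iota // add0n.
apply/idP/idP => [le|wn]; first exact: within_mono nd.
rewrite leqNgt; apply/negP => lt.
have := before_find false lt; rewrite (nth_map 0) ?size_iota; last exact: ltn_trans ltd.
by rewrite nth_iota ?wn //; apply: ltn_trans ltd.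
Qed.

Lemma gdistxx x : d x x = 0.
Proof. by apply/eqP; rewrite -leqn0 gdistP /=. Qed.

Lemma gdist_eq0 x y : (d x y == 0) = (x == y).
Proof. by rewrite -leqn0 gdistP. Qed.

Lemma gdist_triangle y x z : d x z <= d x y + d y z.
Proof.
have /within_path[p pP [pl ps]] : within e (d x y) x y by rewrite -gdistP.
have /within_path[q qP [ql qs]] : within e (d y z) y z by rewrite -gdistP.
rewrite gdistP; apply/within_path; exists (p ++ q).
  by rewrite cat_path pP pl.
by rewrite last_cat pl size_cat leq_add.
Qed.

Lemma gdist_edge x y : e x y -> d x y <= 1.
Proof. by move=> exy; rewrite gdistP /=; apply/orP; right; apply/existsP; exists x; rewrite eqxx. Qed.

Lemma gdist_sym x y : d x y = d y x.
Proof.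
suff h u v : d u v <= d v u by apply/eqP; rewrite eqn_leq !h.
have /within_path[p pP [pl ps]] : within e (d v u) v u by rewrite -gdistP.
rewrite gdistP; apply/within_path; exists (rev (belast v p)).
  have := rev_path e v p; rewrite pl => ->.
  by rewrite (eq_path (e' := e)) // => a b; rewrite e_sym.
split; last by rewrite size_rev size_belast.
case: p pl {pP ps} => [/= <- //|a p] _.
by rewrite /= rev_cons last_rcons.
Qed.

Hypothesis e_irr : irreflexive e.

Lemma gdist_eq1 x y : (d x y == 1) = e x y.
Proof.
apply/eqP/idP => [h|exy].
  have : within e 1 x y by rewrite -gdistP h.
  case/orP => [/= /eqP xy|]; first by rewrite -xy gdistxx in h.
  by case/existsP=> z /andP[/= /eqP ->].
apply/eqP; rewrite eqn_leq gdist_edge // lt0n gdist_eq0.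
by apply: contraTneq exy => ->; rewrite e_irr.
Qed.

Lemma gdist_step x y z : e y z -> d x z <= (d x y).+1 /\ d x y <= (d x z).+1.
Proof.
move=> h; have h1 := gdist_edge h.
have := gdist_triangle y x z; have := gdist_triangle z x y.
by rewrite (gdist_sym z y); lia.
Qed.

Lemma gdist_stepl x y z : e y z -> d z x <= (d y x).+1 /\ d y x <= (d z x).+1.
Proof. by move=> h; rewrite !(gdist_sym _ x); apply: gdist_step. Qed.

Lemma gdist_pred x y n : d x y = n.+1 -> exists2 z, e z y & d x z = n.
Proof.
move=> h; have : within e n.+1 x y by rewrite -gdistP h.
rewrite /= -gdistP h ltnn /= => /existsP[z /andP[wz ezy]]; exists z => //.
have [] := gdist_step x ezy; move: wz; rewrite -gdistP; lia.
Qed.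

End Distance.

(** * Ivanov's diameter bound *)

Lemma exists_setD (T : finType) (A B : {set T}) : #|A| < #|B| -> exists2 x, x \in B & x \notin A.
Proof.
move=> lt; have /set0Pn[x] : B :\: A != set0.
  apply: contraTneq lt => /eqP; rewrite setD_eq0 => /subset_leq_card; lia.
by rewrite inE => /andP[]; exists x.
Qed.

Section Extend.
Variables (T : finType) (e : rel T).
Hypothesis e_sym : symmetric e.
Hypothesis e_dr : distance_regular e.
Notation d := (gdist e).

Let e_conn : gconnected e := proj1 e_dr.
Notation dstep := (gdist_step e_sym e_conn).
Notation dstepl := (gdist_stepl e_sym e_conn).
Notation dtri := (gdist_triangle e_conn).

(** The argument order is opposite to that of [c_num] and [b_num]: the vertex whose neighbours are
    taken comes first. *)
Definition Cs y x := [set z | e y z & d x z == (d x y).-1].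
Definition Bs y x := [set z | e y z & d x z == (d x y).+1].

Lemma geodesic x y n : n <= d x y -> exists2 z, d x z = n & d z y = d x y - n.
Proof.
move: {2}(d x y - n) (erefl (d x y - n)) => t.
elim: t n => [|t IH] n nt le.
  by exists y; [lia | rewrite gdistxx //; lia].
have [||z zx zy] := IH n.+1; [lia|lia|].
have [z' ez' z'x] := gdist_pred e_sym e_conn zx.
exists z' => //; have := dtri z' x y; have := dstepl y ez'; lia.
Qed.

Variables x0 y0 : T.

(** A geodesic from [x0] to [y0] goes on past distance [d x y], so [b_num] is positive at some pair
    at this distance, hence at all of them. *)
Lemma b_num_gt0 x y : d x y < d x0 y0 -> exists2 z, e y z & d x z = (d x y).+1.
Proof.
move=> lt; have [z' z'x _] := geodesic lt.
have [z ez zx] := gdist_pred e_sym e_conn z'x.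
have [_] := (proj2 e_dr) x y x0 z (esym zx).
have : 0 < b_num e x0 z by apply/card_gt0P; exists z'; rewrite inE ez /= z'x zx.
move=> h eb; move: h; rewrite -eb => /card_gt0P[w]; rewrite inE => /andP[ew /eqP].
by exists w.
Qed.

Lemma geodesic_extend x y n : d x y + n <= d x0 y0 ->
  exists2 z, d x z = d x y + n & d y z = n.
Proof.
elim: n => [|n IH] le.
  by exists y; rewrite ?addn0 ?gdistxx.
have [|z zx zy] := IH; first lia.
have [|w ezw wx] := b_num_gt0 (x := x) (y := z); first lia.
exists w; first lia.
have := dstep y ezw; have := dtri y x w; lia.
Qed.

End Extend.

Section Stretch.
Variables (T : finType) (e : rel T).
Hypothesis e_sym : symmetric e.
Hypothesis e_dr : distance_regular e.
Notation d := (gdist e).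
Let e_conn : gconnected e := proj1 e_dr.
Notation Cs := (Cs e).
Notation Bs := (Bs e).
Variables i c b : nat.
Hypothesis cE : forall x y, i <= d x y <= i.*2 -> c_num e x y = c.
Hypothesis bE : forall x y, i <= d x y <= i.*2 -> b_num e x y = b.

Notation dstep := (gdist_step e_sym e_conn).
Notation dstepl := (gdist_stepl e_sym e_conn).
Notation dC := (gdist_sym e_sym e_conn).
Notation dtri := (gdist_triangle e_conn).

Lemma card_Cs y x : #|Cs y x| = c_num e x y. Proof. by []. Qed.
Lemma card_Bs y x : #|Bs y x| = b_num e x y. Proof. by []. Qed.

(** [Cs z X' \subset Cs z X] and [Bs z X \subset Bs z X'] always hold; in the stretch both are
    equalities by cardinality, so moving [X] along a geodesic to [z] shifts the distances to
    all neighbours of [z] by the same amount. *)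
Lemma shift_geodesic z w X X' : e X X' -> e z w ->
  d X z = (d X' z).+1 -> i <= d X' z -> d X z <= i.*2 -> d X w = (d X' w).+1.
Proof.
move=> eX ez dz li lL.
have [s1 s2] := dstepl w eX; have [t1 t2] := dstep X ez; have [r1 r2] := dstep X' ez.
have EC : Cs z X' = Cs z X.
  apply/eqP; rewrite eqEcard; apply/andP; split; last first.
    by rewrite !card_Cs !cE //; lia.
  apply/subsetP=> v; rewrite !inE => /andP[ev /eqP dv]; rewrite ev /=.
  have [? ?] := dstepl v eX; have [? ?] := dstep X ev; apply/eqP; lia.
have EB : Bs z X = Bs z X'.
  apply/eqP; rewrite eqEcard; apply/andP; split; last first.
    by rewrite !card_Bs !bE //; lia.
  apply/subsetP=> v; rewrite !inE => /andP[ev /eqP dv]; rewrite ev /=.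
  have [? ?] := dstepl v eX; have [? ?] := dstep X' ev; apply/eqP; lia.
move/setP: EC => /(_ w); move/setP: EB => /(_ w); rewrite !inE ez /=; lia.
Qed.

(** Iterates [shift_geodesic] along a geodesic from [X] to [X0], whose vertices have distances to
    [z] between those of [X0] and [X]. *)
Lemma shift_geodesics z w X X0 : e z w ->
  d X z = d X X0 + d X0 z -> i <= d X0 z -> d X z <= i.*2 -> d X w = d X X0 + d X0 w.
Proof.
move=> ez; move: {2}(d X X0) (erefl (d X X0)) => t.
elim: t X => [|t IH] X dt dz li lL.
  by move: dt => /eqP; rewrite (gdist_eq0 e_conn) => /eqP <-; rewrite gdistxx.
move: (dt); rewrite dC => dt'.
have [X' eX dX'] := gdist_pred e_sym e_conn dt'.
rewrite e_sym in eX; rewrite dC in dX'.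
have [? ?] := dstepl z eX; have := dtri X0 X' z => ?.
have h1 : d X z = (d X' z).+1 by lia.
have h2 : d X' z = d X' X0 + d X0 z by lia.
have := IH X' dX' h2 li; rewrite (shift_geodesic eX ez h1); lia.
Qed.

(** Shifting along the edge [z w] instead: the partition of the neighbours of [X] is the same
    seen from [z] and from [w]. *)
Lemma flat_up z w X X' : e X X' -> e z w -> d X z = d X' z -> i <= d X z < i.*2 ->
  d X w = (d X z).+1 -> d X' w = (d X' z).+1.
Proof.
move=> eX ez dz li dw; rewrite e_sym in ez.
have := @shift_geodesic X X' w z ez eX; rewrite !(dC w) !(dC z); lia.
Qed.

Lemma flat_down z w X X' : e X X' -> e z w -> d X z = d X' z -> i < d X z <= i.*2 ->
  (d X w).+1 = d X z -> (d X' w).+1 = d X' z.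
Proof.
move=> eX ez dz li dw.
have := @shift_geodesic X X' z w ez eX; rewrite !(dC w) !(dC z); lia.
Qed.

(** If the distance to [z] differs at [X] and [X'] this is [shift_geodesic], otherwise [flat_up].
    Only the latter needs [w] to stay within the stretch, whence the conditional bound. *)
Lemma move_up z w X X' : e X X' -> e z w -> i <= d X z <= i.*2 -> i <= d X' z <= i.*2 ->
  (d X z = d X' z -> d X z < i.*2) ->
  d X w = (d X z).+1 -> d X' w = (d X' z).+1.
Proof.
move=> eX ez h1 h2 h3 dw; have [? ?] := dstepl z eX.
have eX' : e X' X by rewrite e_sym.
case: (ltngtP (d X z) (d X' z)) => h.
- have := shift_geodesic eX' ez; lia.
- have := shift_geodesic eX ez; lia.
by apply: (flat_up eX ez h) => //; have := h3 h; lia.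
Qed.

Lemma move_down z w X X' : e X X' -> e z w -> i < d X z <= i.*2 -> i < d X' z <= i.*2 ->
  (d X w).+1 = d X z -> (d X' w).+1 = d X' z.
Proof.
move=> eX ez h1 h2 dw; have [? ?] := dstepl z eX.
have eX' : e X' X by rewrite e_sym.
case: (ltngtP (d X z) (d X' z)) => h.
- have := shift_geodesic eX' ez; lia.
- have := shift_geodesic eX ez; lia.
by apply: (flat_down eX ez h) => //; lia.
Qed.

End Stretch.

Section Ivanov.
Variables (T : finType) (e : rel T).
Hypothesis e_sym : symmetric e.
Hypothesis e_irr : irreflexive e.
Hypothesis e_dr : distance_regular e.
Notation d := (gdist e).
Let e_conn : gconnected e := proj1 e_dr.
Notation Cs := (Cs e).
Notation Bs := (Bs e).
Variables i c b c' b' : nat.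
Hypothesis i2 : 2 <= i.
Hypothesis cE : forall x y, i <= d x y <= i.*2 -> c_num e x y = c.
Hypothesis bE : forall x y, i <= d x y <= i.*2 -> b_num e x y = b.
Hypothesis c'E : forall x y, d x y = i.-1 -> c_num e x y = c'.
Hypothesis b'E : forall x y, d x y = i.-1 -> b_num e x y = b'.
Variables x0 y0 : T.
Hypothesis far : i.*2 <= d x0 y0.

Notation dstep := (gdist_step e_sym e_conn).
Notation dstepl := (gdist_stepl e_sym e_conn).
Notation dC := (gdist_sym e_sym e_conn).
Notation dtri := (gdist_triangle e_conn).
Notation move_up := (move_up e_sym e_dr cE bE).
Notation move_down := (move_down e_sym e_dr cE bE).
Notation shift_geodesics := (shift_geodesics e_sym e_dr cE bE).

Let extend x y n : d x y + n <= i.*2 -> exists2 z, d x z = d x y + n & d y z = n.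
Proof. by move=> h; apply: (geodesic_extend e_sym e_dr (x0 := x0) (y0 := y0)); lia. Qed.

Lemma closer x y : 0 < d x y -> exists2 z, e z y & (d x z).+1 = d x y.
Proof.
move=> h; have h' : d x y = (d x y).-1.+1 by lia.
have [z ez dz] := gdist_pred e_sym e_conn h'; exists z => //; lia.
Qed.

(** [move_up] is applied along a geodesic from [al] to [ee], on which the distances to [u] stay
    between [i] and [2 i - 1]. *)
Lemma away_up u al ee w : d u al = i.*2.-2 -> d u ee = i -> d al ee = i.-1 ->
  e u w -> d al w = (d al u).+1 -> d ee w = (d ee u).+1.
Proof.
move=> dua due dae euw daw; have ? := dC u ee; have ? := dC u al.
suff H t : forall f, d al f = t -> i <= d f u -> d f u + t <= i.*2.-1 -> t <= i.-1 ->
   d f w = (d f u).+1 by apply: (H i.-1) => //; lia.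
elim: t => [|t IH] f dt h1 h2 h3.
  by move/eqP: dt; rewrite gdist_eq0 // => /eqP <-.
have [f' ef df'] := gdist_pred e_sym e_conn dt.
have [? ?] := dstepl u ef; have ? := dtri f' al u; have ? := dC f' al.
have := IH f' df'; have := @move_up _ _ _ _ ef euw; lia.
Qed.

(** The [c] vertices of [Cs p al] all lie in [Cs p x1], which also has [c] elements but contains
    the neighbours of [p] closer to [u]; those of [Cs p al] are as far from [u] as [p] is. *)
Lemma no_stretch_after_c_jump : b' = b -> c' < c -> False.
Proof.
move=> bb cc; set x := x0.
have [v xv _] : exists2 v, d x v = d x x + i & d x v = i.
  apply: extend; rewrite gdistxx //; lia.
rewrite gdistxx // add0n in xv; have vx := dC v x.
have [u ux uv] : exists2 u, e u x & (d v u).+1 = d v x by apply: closer; lia.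
have exu : e x u by rewrite e_sym.
have Cvx : #|Cs v x| = c by rewrite card_Cs cE; lia.
have uv' := dC u v.
have Cvu : #|Cs v u| = c' by rewrite card_Cs c'E; lia.
have Bi y z : i.-1 <= d y z <= i.*2 -> #|Bs z y| = b.
  rewrite card_Bs => h; have [hh|hh] := leqP i (d y z); first by rewrite bE ?hh //; lia.
  by rewrite b'E //; lia.
have [p] : exists2 p, p \in Cs v x & p \notin Cs v u by apply: exists_setD; lia.
rewrite !inE => /andP[evp /eqP xp]; rewrite evp /= => /eqP up.
(* [Bs v x] is contained in [Bs v u], and [b' = b] makes them equal; so [p], which lies outside the
   first, is not at distance [i] from [u]. *)
have up' : d u p = i.-1.
  have EB : Bs v x = Bs v u.
    apply/eqP; rewrite eqEcard !Bi ?leqnn ?andbT; [|lia|lia].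
    apply/subsetP=> w; rewrite !inE => /andP[evw /eqP xw]; rewrite evw /=; apply/eqP.
    have [? ?] := dstepl w exu; have [? ?] := dstep u evw; lia.
  have [? ?] := dstepl p exu; have [? ?] := dstep u evp.
  move/setP: EB => /(_ p); rewrite !inE evp /=; lia.
have pu := dC p u; have px := dC p x.
(* [Bs u p] and [Bs u v] both have [b] elements, and [x] lies in the second only. *)
have [x1] : exists2 x1, x1 \in Bs u p & x1 \notin Bs u v.
  suff h : ~~ (Bs u p \subset Bs u v) by have [y] := subsetPn h; exists y.
  apply/negP=> sub; have /eqP EB : Bs u p == Bs u v by rewrite eqEcard sub !Bi; lia.
  by move/setP: EB => /(_ x); rewrite !inE ux /=; lia.
rewrite !inE => /andP[eux1 /eqP px1]; rewrite eux1 /= => /eqP vx1.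
(* The geodesic from [x] through [u] to [v] is prolonged by [i - 1] steps, which puts [al] at
   distance [2 i - 2] from [u] and [i] from [p]. *)
have [al xal val] : exists2 al, d x al = d x v + i.-1 & d v al = i.-1.
  apply: extend; lia.
have pv : d p v = 1 by apply/eqP; rewrite gdist_eq1 // e_sym.
have ux' : d u x = 1 by apply/eqP; rewrite gdist_eq1.
have pal : d p al = i by have := dtri p x al; have := dtri v p al; lia.
have ual : d u al = i.*2.-2 by have := dtri u x al; have := dtri v u al; have := dC u x; lia.
have alu := dC al u; have palC := dC p al.
have Buv : Bs u al = Bs u v.
  apply/eqP; rewrite eqEcard !Bi ?leqnn ?andbT; [|lia|lia].
  apply/subsetP=> w; rewrite !inE => /andP[euw /eqP alw]; rewrite euw /=; apply/eqP.
  have := dtri v al w; have := dC v al; have [? ?] := dstep v euw; lia.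
have key ee : ee \in Cs p al -> d u ee = i.-1 /\ d x1 ee = i.-1.
  rewrite inE => /andP[epe /eqP ale].
  have eal := dC al ee; have eu := dC u ee.
  have uee : d u ee = i.-1.
    have [? ?] := dstep u epe; have := dtri ee u al.
    have [|] := eqVneq (d u ee) i; last by lia.
    (* Here [away_up] yields [Bs u al = Bs u p], although [x] lies in the first, which is [Bs u v],
       and not in the second. *)
    move=> hue; exfalso.
    have sub : Bs u al \subset Bs u p.
      apply/subsetP=> w; rewrite !inE => /andP[euw /eqP alw]; rewrite euw /=; apply/eqP.
      have := @away_up u al ee w ual hue _ euw alw.
      have [? ?] := dstep p euw; have [? ?] := dstepl w epe; have := dC al p; lia.
    have /eqP EB : Bs u al == Bs u p by rewrite eqEcard sub !Bi; lia.
    by move/setP: EB => /(_ x); rewrite Buv !inE ux /=; lia.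
  split=> //.
  have EB : Bs u al = Bs u ee.
    apply/eqP; rewrite eqEcard !Bi ?leqnn ?andbT; [|lia|lia].
    apply/subsetP=> w; rewrite !inE => /andP[euw /eqP alw]; rewrite euw /=; apply/eqP.
    have := dtri ee al w; have := dC al p; have [? ?] := dstep ee euw; lia.
  move/setP: EB => /(_ x1); rewrite Buv !inE eux1 /=.
  have := dC x1 ee; have [? ?] := dstepl x1 epe; have [? ?] := dstep ee eux1.
  by move: vx1 => /eqP/negbTE ->; move/esym/eqP; lia.
have EC : Cs p al = Cs p x1.
  have px1' := dC p x1.
  apply/eqP; rewrite eqEcard !card_Cs !cE ?leqnn ?andbT; [|lia|lia].
  apply/subsetP=> ee h; have [_ h2] := key ee h; move: h; rewrite !inE => /andP[-> _] /=.
  by rewrite h2; apply/eqP; lia.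
have [t etp ut] : exists2 t, e t p & (d u t).+1 = d u p by apply: closer; lia.
have : t \in Cs p x1.
  rewrite inE e_sym etp /=; have := dtri u x1 t; have := dC x1 u.
  have : d u x1 = 1 by apply/eqP; rewrite gdist_eq1.
  have [? ?] := dstep x1 etp; have := dC p x1; move=> *; apply/eqP; lia.
by rewrite -EC => /key[]; lia.
Qed.

(** If [w] were closer to [xi], shifting along the geodesics from [xi] to [v] through elements of
    [Cs u xi] would give [Cs u xi = Cs u w]. A neighbour of [u] nearer to [v] lies in the second set
    but is too near [v] for the first. *)
Lemma far_not_closer v u xi w : d v u = i.-1 -> d v xi = i.*2.-1 -> d u xi = i ->
  e v w -> d u w = i -> (d xi w).+1 <> d xi v.
Proof.
move=> vu vxi uxi evw uw xiw; have ? := dC xi v; have ? := dC u xi; have ? := dC w u.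
have EC : Cs u xi = Cs u w.
  apply/eqP; rewrite eqEcard !card_Cs !cE ?leqnn ?andbT; [|lia|lia].
  apply/subsetP=> x; rewrite !inE => /andP[eux /eqP xix]; rewrite eux /=; apply/eqP.
  have [? ?] := dstep v eux; have := dtri x v xi; have ? := dC x xi.
  have ? := dC v x; have := @shift_geodesics v w xi x evw; have := dC x w; lia.
have [t etu vt] : exists2 t, e t u & (d v t).+1 = d v u by apply: closer; lia.
have : t \in Cs u w.
  rewrite inE e_sym etu; have [? ?] := dstepl t evw; have [? ?] := dstep w etu.
  by apply/eqP; lia.
rewrite -EC inE => /andP[_ /eqP]; have := dtri t v xi; have := dC t xi; lia.
Qed.

(** [move_down] is applied along the edge [r q] and then along a geodesic from [q] to [f], on which
    the distances to [x] stay above [i] and at most [2 i]. *)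
Lemma far_down x u r q : e x u -> d r x = i.*2.-1 -> (d r u).+1 = d r x -> e r q ->
  i.*2.-1 <= d q x -> forall f t, d q f = t -> i < d f x -> t < i -> d f x + t <= i.*2 ->
  (d f u).+1 = d f x.
Proof.
move=> exu rx ru erq qx f t; elim: t f => [|t IH] f dt h1 h2 h3.
  move/eqP: dt; rewrite gdist_eq0 // => /eqP qf; rewrite qf in erq qx h1 h3 *.
  by apply: (move_down erq exu _ _ ru); lia.
have [f' ef df'] := gdist_pred e_sym e_conn dt.
have [? ?] := dstepl x ef; have := dtri f' q x => ?.
by apply: (move_down ef exu _ _ (IH f' df' _ _ _)); lia.
Qed.

(** Here [Cs w u], of size [c], would contain the [c] vertices of [Cs w q] and also [v]. *)
Lemma no_stretch_after_b_jump : b < b' -> False.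
Proof.
move=> bb; set u := x0.
have [v uv _] : exists2 v, d u v = d u u + i.-1 & d u v = i.-1.
  by apply: extend; rewrite gdistxx //; lia.
rewrite gdistxx // add0n in uv; have vu := dC v u.
have [xi vxi uxi] : exists2 xi, d v xi = d v u + i & d u xi = i by apply: extend; lia.
have vxi' := dC v xi; have uxi' := dC u xi.
(* [w] exists because [b < b']. Its distance from [xi] is not [2 i], and [far_not_closer] excludes
   [2 i - 2], so it is [2 i - 1]. *)
have [w] : exists2 w, w \in Bs v u & w \notin Bs v xi.
  by apply: exists_setD; rewrite !card_Bs bE ?(b'E uv) //; lia.
rewrite !inE => /andP[evw /eqP uw]; rewrite evw /= => /eqP xiw.
have [? ?] := dstep xi evw.
have := @far_not_closer v u xi w _ _ uxi evw => far1.
have xiw' : d xi w = i.*2.-1 by lia.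
clear far1.
have [x exu xix] : exists2 x, e x u & (d xi x).+1 = d xi u by apply: closer; lia.
have eux : e u x by rewrite e_sym.
have xv : d x v = i by have [? ?] := dstepl v exu; have := dtri x xi v; lia.
have xw : d x w = i by have := @shift_geodesics v w xi x evw; lia.
have wx := dC w x; have vx := dC v x; have wu := dC w u.
have [r xr vr] : exists2 r, d x r = d x v + i.-1 & d v r = i.-1 by apply: extend; lia.
have rx := dC r x; have rv := dC r v; have rw := dC r w; have ru := dC r u.
have ru' : d r u = i.*2.-2 by have := @shift_geodesics x u r v exu; lia.
have ewv : e w v by rewrite e_sym.
have wr : d w r = i.
  have := dtri w x r; have [? ?] := dstepl r evw => ?.
  by have := @shift_geodesics x u r w exu; lia.
(* The triple [r], [v], [om] has the same mutual distances as [v], [u], [xi], and [q] is to it what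
   [w] is to the earlier one. *)
have [om rom wom] : exists2 om, d r om = d r w + i.-1 & d w om = i.-1 by apply: extend; lia.
have omr := dC om r; have omw := dC om w; have omv := dC om v.
have vom : d v om = i by have [? ?] := dstepl om evw; have := dtri v r om; lia.
have [q] : exists2 q, q \in Bs r v & q \notin Bs r om.
  by apply: exists_setD; rewrite !card_Bs bE ?b'E //; lia.
rewrite !inE => /andP[erq /eqP vq]; rewrite erq /= => /eqP omq.
have far2 := @far_not_closer r v om q _ _ vom erq; have [? ?] := dstep om erq.
have wq : d w q = i by have := @shift_geodesics r q om w erq; lia.
have far3 := @far_not_closer r v x q _ _ _ erq; have [? ?] := dstep x erq.
have xq : i.*2.-1 <= d x q by lia.
clear far2 far3.
have qx := dC q x; have qw := dC q w; have qv := dC q v.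
have down f : i < d f x -> d q f < i -> d f x + d q f <= i.*2 -> (d f u).+1 = d f x.
  by move=> h1 h2 h3; apply: (far_down exu _ _ erq _ (erefl (d q f))) => //; lia.
have sub : v |: Cs w q \subset Cs w u.
  apply/subsetP=> ee; rewrite !inE => /orP[/eqP ->|/andP[ewe /eqP qe]].
    by rewrite ewv /=; apply/eqP; lia.
  rewrite ewe /=; apply/eqP; have uee := dC u ee; have xee := dC x ee; have qee := dC q ee.
  have [? ?] := dstep x ewe; have := dtri ee q x => tr.
  (* At distance [i + 1] from [x], the vertex [ee] would be at distance [i] from [u] by [down] and
     at distance [i + 1] by [shift_geodesic]. *)
  have eex : d ee x = i.
    have eew : e ee w by rewrite e_sym.
    have [//|ne] := eqVneq (d ee x) i; exfalso; have eex : d ee x = i.+1 by lia.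
    have eeu : (d ee u).+1 = d ee x by apply: down; lia.
    have := shift_geodesic e_sym e_dr cE bE eew exu; lia.
  (* One step nearer to [q] the distance to [x] is [i + 1], so [down] applies to [f1], and
     [shift_geodesic] carries its conclusion back to [ee]. *)
  have [f1 ef1 qf1] : exists2 f1, e f1 ee & (d q f1).+1 = d q ee by apply: closer; lia.
  have [? ?] := dstepl x ef1; have := dtri f1 q x => tr1.
  have f1u : (d f1 u).+1 = d f1 x by apply: down; lia.
  have := shift_geodesic e_sym e_dr cE bE ef1 exu; lia.
have := subset_leq_card sub; rewrite cardsU1 !card_Cs !cE ?inE ?ewv; lia.
Qed.

End Ivanov.

Lemma card_bigcup_le (I T : finType) (P : pred I) (F : I -> {set T}) :
  #|\bigcup_(i | P i) F i| <= \sum_(i | P i) #|F i|.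
Proof.
elim/big_rec2: _ => [|i n A _ IH]; first by rewrite cards0.
by apply: leq_trans (leq_card_setU _ _) _; rewrite leq_add2l.
Qed.

(** * Changes in the intersection array, and the order in terms of the valency *)

Section Bound.
Variables (T : finType) (e : rel T).
Hypothesis e_sym : symmetric e.
Hypothesis e_irr : irreflexive e.
Hypothesis e_dr : distance_regular e.
Notation d := (gdist e).
Let e_conn : gconnected e := proj1 e_dr.

Lemma deg_b_num x : deg e x = b_num e x x.
Proof.
apply: eq_card => z; rewrite !inE gdistxx // (gdist_eq1 e_conn e_irr).
by rewrite andbb.
Qed.

Lemma deg_regular x y : deg e x = deg e y.
Proof. by rewrite !deg_b_num; apply: (proj2 (proj2 e_dr x x y y _)); rewrite !gdistxx. Qed.

Lemma c_num_le_deg x y : c_num e x y <= deg e y.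
Proof. by apply: subset_leq_card; apply/subsetP=> z; rewrite !inE => /andP[]. Qed.

Lemma b_num_le_deg x y : b_num e x y <= deg e y.
Proof. by apply: subset_leq_card; apply/subsetP=> z; rewrite !inE => /andP[]. Qed.

Lemma c_num1 x y : e x y -> c_num e x y = 1.
Proof.
move=> exy; have /eqP dxy : gdist e x y == 1 by rewrite gdist_eq1.
rewrite /c_num dxy -[RHS](cards1 x); apply: eq_card => z; rewrite !inE (gdist_eq0 e_conn) andbC eq_sym.
by case: eqP => // ->; rewrite e_sym exy.
Qed.

Lemma card_ball n x : #|[set y | d x y <= n]| <= (deg e x).+1 ^ n.
Proof.
elim: n => [|n IH].
  rewrite expn0 -(cards1 x); apply: subset_leq_card; apply/subsetP=> y.
  by rewrite !inE leqn0 (gdist_eq0 e_conn) eq_sym.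
have sub : [set y | d x y <= n.+1] \subset
    \bigcup_(z in [set y | d x y <= n]) (z |: nbhd e z).
  apply/subsetP=> y; rewrite inE leq_eqVlt => /orP[/eqP dy|dy].
    have [z ez dz] := gdist_pred e_sym e_conn dy.
    by apply/bigcupP; exists z; rewrite !inE ?dz ?ez ?orbT.
  by apply/bigcupP; exists y; rewrite !inE ?eqxx.
apply: leq_trans (subset_leq_card sub) _; apply: leq_trans (card_bigcup_le _ _) _.
rewrite expnSr; apply: leq_trans (leq_mul IH (leqnn _)).
rewrite -sum_nat_const leq_sum // => z _.
by rewrite cardsU1 inE e_irr add1n -(deg_regular z x).
Qed.

Section Column.
Variables x0 y0 : T.

(** Some vertex at distance [l] from [x0], with junk value [x0] if there is none. *)
Definition at_dist l := odflt x0 [pick z | d x0 z == l].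

Lemma at_distP l : l <= d x0 y0 -> d x0 (at_dist l) = l.
Proof.
move=> le; have [z dz _] := geodesic e_sym e_dr le.
by rewrite /at_dist; case: pickP => [w /eqP //|/(_ z)]; rewrite dz eqxx.
Qed.

Definition ccol l := c_num e x0 (at_dist l).
Definition bcol l := b_num e x0 (at_dist l).

Lemma c_numE x y : d x y <= d x0 y0 -> c_num e x y = ccol (d x y).
Proof. by move=> /at_distP h; apply: (proj1 (proj2 e_dr _ _ _ _ _)). Qed.

Lemma b_numE x y : d x y <= d x0 y0 -> b_num e x y = bcol (d x y).
Proof. by move=> /at_distP h; apply: (proj2 (proj2 e_dr _ _ _ _ _)). Qed.

(** Let [x] follow [x0] on a geodesic to [z]. A neighbour of [z] that is nearer to [x] is also
    nearer to [x0], and one that is further from [x0] is also further from [x]. *)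
Lemma column_mono l : l < d x0 y0 -> ccol l <= ccol l.+1 /\ bcol l.+1 <= bcol l.
Proof.
move=> lt; have [z dz _] := geodesic e_sym e_dr lt.
have [x ex dx] : exists2 x, e x x0 & d z x = l.
  by apply: (gdist_pred e_sym e_conn); rewrite (gdist_sym e_sym e_conn).
rewrite (gdist_sym e_sym e_conn) in dx.
have := c_numE (x := x0) (y := z); have := b_numE (x := x0) (y := z).
have := c_numE (x := x) (y := z); have := b_numE (x := x) (y := z).
rewrite dz dx => <-; last exact: ltnW.
move=> <-; last exact: ltnW.
move=> <- // <- //.
split; apply: subset_leq_card; apply/subsetP=> w; rewrite !inE => /andP[ezw /eqP dw].
  rewrite ezw /=; have [] := gdist_stepl e_sym e_conn w ex; have [] := gdist_step e_sym e_conn x0 ezw.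
  have := gdist_triangle e_conn x z w; have := gdist_sym e_sym e_conn z x.
  have /eqP : d z w == 1 by rewrite gdist_eq1.
  by move=> *; apply/eqP; lia.
rewrite ezw /=; have [] := gdist_stepl e_sym e_conn w ex; have [] := gdist_step e_sym e_conn x ezw.
by move=> *; apply/eqP; lia.
Qed.

(** Drops at every change of column. *)
Definition col_rank l := bcol l + (deg e x0 - ccol l).

Lemma ccol_le l : ccol l <= deg e x0.
Proof. by rewrite (deg_regular x0 (at_dist l)) c_num_le_deg. Qed.

Lemma col_rank_mono l l' : l <= l' -> l' <= d x0 y0 -> col_rank l' <= col_rank l.
Proof.
elim: l' => [|l' IH]; first by rewrite leqn0 => /eqP ->.
rewrite leq_eqVlt => /orP[/eqP -> //|le] lt.
apply: leq_trans (IH le (ltnW lt)); have [? ?] := column_mono lt; rewrite /col_rank; lia.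
Qed.

Lemma col_rank_eq l : l < d x0 y0 -> col_rank l.+1 = col_rank l ->
  ccol l.+1 = ccol l /\ bcol l.+1 = bcol l.
Proof.
move=> lt; have [? ?] := column_mono lt; have := ccol_le l.+1; have := ccol_le l.
rewrite /col_rank; lia.
Qed.

(** Otherwise columns [i .. 2 i] coincide. The drop of [col_rank] at [i] means that [b] falls there,
    or that [b] stays and [c] grows; each case is excluded above. *)
Lemma exists_column_change i : 1 < i -> i.*2 <= d x0 y0 -> col_rank i < col_rank i.-1 ->
  exists l, [/\ i < l, l <= i.*2 & col_rank l < col_rank l.-1].
Proof.
move=> i2 le lt.
have [/existsP[l /andP[il ll]]|] :=
    boolP [exists l : 'I_(i.*2).+1, (i < l) && (col_rank l < col_rank l.-1)].
  by exists l; split=> //; rewrite -ltnS.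
rewrite negb_exists => /forallP h.
have same j : i + j <= i.*2 -> ccol (i + j) = ccol i /\ bcol (i + j) = bcol i.
  elim: j => [|j IH] hj; rewrite ?addn0 //; rewrite addnS in hj *.
  have [|<- <-] := IH; first exact: ltnW.
  apply: col_rank_eq; first lia; apply/eqP; rewrite eqn_leq col_rank_mono //=; last lia.
  have hj' : (i + j).+1 < (i.*2).+1 by lia.
  have := h (Ordinal hj'); rewrite negb_and -!leqNgt /=; lia.
have same' x y : i <= d x y <= i.*2 -> c_num e x y = ccol i /\ b_num e x y = bcol i.
  move=> hd; rewrite c_numE ?b_numE; [|lia|lia].
  by have := same (d x y - i); rewrite subnKC; [apply; lia|lia].
exfalso; have pE x y : d x y = i.-1 -> c_num e x y = ccol i.-1 /\ b_num e x y = bcol i.-1.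
  by move=> hd; rewrite c_numE ?b_numE ?hd //; lia.
have far := le.
have := @no_stretch_after_c_jump T e e_sym e_irr e_dr i _ _ _ _ i2 (fun x y h => proj1 (same' x y h))
 (fun x y h => proj2 (same' x y h)) (fun x y h => proj1 (pE x y h)) (fun x y h => proj2 (pE x y h)) x0 y0 far.
have := @no_stretch_after_b_jump T e e_sym e_dr i _ _ _ i2 (fun x y h => proj1 (same' x y h))
 (fun x y h => proj2 (same' x y h)) (fun x y h => proj2 (pE x y h)) x0 y0 far.
have [] := @column_mono i.-1; first lia.
have := ccol_le i; have := ccol_le i.-1; move: lt; rewrite /col_rank prednK; lia.
Qed.

Hypothesis mu2 : forall x y : T, d x y = 2 -> 2 <= c_num e x y.

(** The first change is at column 2, where [c] exceeds [c_1 = 1]; each further one is found before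
    the column number has doubled. *)
Lemma exists_late_column_change t : 2 ^ t.+1 <= d x0 y0 ->
  exists i, [/\ 1 < i, i <= 2 ^ t.+1, col_rank i < col_rank i.-1 & col_rank i + t.+1 <= col_rank 1].
Proof.
elim: t => [|t IH] le.
  rewrite expn1 in le; exists 2; rewrite expn1.
  suff h : col_rank 2 < col_rank 1 by rewrite /= addn1.
  have [? ?] := @column_mono 1 le.
  have : 1 < ccol 2 by rewrite -(at_distP le) -c_numE ?at_distP // mu2 ?at_distP.
  have /at_distP d1 : 1 <= d x0 y0 by lia.
  have : ccol 1 = 1 by rewrite /ccol c_num1 // -(gdist_eq1 e_conn e_irr) d1.
  have := ccol_le 2; rewrite /col_rank; lia.
rewrite expnS in le; have [|i [i2 ile lt rk]] := IH; first lia.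
have [|l [il ll lr]] := exists_column_change i2 _ lt; first lia.
exists l; rewrite expnS; split; [lia|lia|done|].
have : col_rank l.-1 <= col_rank i by apply: col_rank_mono; lia.
lia.
Qed.

(** [col_rank 1] is at most twice the valency, so it cannot drop once more than that. *)
Lemma gdist_bound : d x0 y0 < 2 ^ (deg e x0).*2.+1.
Proof.
rewrite ltnNge; apply/negP => /exists_late_column_change[i [_ _ _]].
have : bcol 1 <= deg e x0 by rewrite (deg_regular x0 (at_dist 1)) b_num_le_deg.
by rewrite /col_rank; lia.
Qed.

End Column.

Lemma card_bound k : (forall x y : T, d x y = 2 -> 2 <= c_num e x y) ->
  (forall x, deg e x <= k) -> #|T| <= k.+1 ^ 2 ^ k.*2.+1.
Proof.
move=> mu2 dk; have [->|/card_gt0P[x _]] := posnP #|T|; first by [].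
have -> : #|T| = #|[set y | d x y <= 2 ^ k.*2.+1]|.
  symmetry; apply: eq_card => y; rewrite !inE; apply: ltnW.
  apply: leq_trans (gdist_bound x y mu2) _; rewrite leq_exp2l // ltnS leq_double; exact: dk.
by apply: leq_trans (card_ball _ _) _; rewrite leq_exp2r ?expn_gt0 // ltnS.
Qed.

End Bound.

(** * Configurations excluded by the smallest eigenvalue *)

Section Spectral.
Local Open Scope ring_scope.
Local Open Scope sesquilinear_scope.

(** In an orthonormal basis of eigenvectors the form is a sum of squared moduli weighted by
    eigenvalues. *)
Lemma hermitian_form_ge n (A : 'M[algC]_n) (c : algC) (w : 'rV_n) :
  A ^t* = A -> (forall a, eigenvalue A a -> c <= a) ->
  c * (w *m w ^t*) 0 0 <= (w *m A *m w ^t*) 0 0.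
Proof.
move=> Ah cle; have An : A \is normalmx by apply/normalmxP; rewrite Ah.
have /orthomx_spectralP := An; set P := spectralmx A; set D := spectral_diag A => AE.
have Pu : P \is unitarymx := spectral_unitarymx A.
have PV : invmx P = P ^t* by rewrite invmx_unitary.
have PA : P *m A = diag_mx D *m P.
  by rewrite {1}AE !mulmxA mulmxV ?mul1mx // spectral_unit.
have Dge i : c <= D 0 i.
  apply: cle; apply/eigenvalueP; exists (row i P); last first.
    apply/eqP => r0; have := unitarymxP Pu => /matrixP/(_ i i).
    rewrite !mxE eqxx big1 => [/eqP|j _]; first by rewrite eq_sym oner_eq0.
    by move/rowP: r0 => /(_ j); rewrite !mxE => ->; rewrite mul0r.
  by rewrite -row_mul PA; apply/rowP=> j; rewrite mul_diag_mx !mxE.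
set u := w *m P ^t*.
have wE : w = u *m P by rewrite /u -PV mulmxKV // spectral_unit.
have uE : w ^t* = P ^t* *m u ^t* by rewrite {1}wE trmx_mul map_mxM.
have -> : w *m w ^t* = u *m u ^t*.
  by rewrite uE {1}wE mulmxA mulmxtVK.
have -> : w *m A *m w ^t* = u *m diag_mx D *m u ^t*.
  by rewrite uE {1}wE mulmxA -(mulmxA u P A) PA !mulmxA mulmxtVK.
clearbody u; rewrite mul_mx_diag !mxE mulr_sumr; apply: ler_sum => i _.
rewrite !mxE [u 0 i * D 0 i]mulrC -mulrA ler_wpM2r ?Dge //.
by rewrite -normCK exprn_ge0.
Qed.

(** Integer test vectors suffice below and keep their evaluation within integer arithmetic. *)
Lemma adjacency_form_ge (T : finType) (e : rel T) (m : nat) (v : T -> int) :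
  symmetric e -> (forall a, eigenvalue (adjmx e) a -> - m%:R <= a) ->
  0 <= \sum_x \sum_y (e x y)%:R * (v x * v y) + m%:R * \sum_x v x ^+ 2.
Proof.
move=> e_sym ge; pose w : 'rV[algC]_#|T| := \row_i (v (enum_val i))%:~R.
have wr : w ^t* = w^T by apply/colP=> i; rewrite !mxE; apply: CrealP; apply: rpred_int.
have Ar : (adjmx e) ^t* = adjmx e.
  by apply/matrixP=> i j; rewrite !mxE rmorph_nat e_sym.
have := hermitian_form_ge w Ar ge; rewrite wr -subr_ge0 mulNr opprK.
suff -> : (w *m adjmx e *m w^T) 0 0 + m%:R * (w *m w^T) 0 0 =
  (\sum_x \sum_y (e x y)%:R * (v x * v y) + m%:R * \sum_x v x ^+ 2)%:~R.
  by rewrite ler0z.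
rewrite rmorphD rmorphM /= rmorph_nat !rmorph_sum /=; congr (_ + _ * _).
  rewrite mxE (reindex _ (onW_bij _ (@enum_rank_bij T))) /=.
  under eq_bigr => y _.
    rewrite !mxE (reindex _ (onW_bij _ (@enum_rank_bij T))) /= mulr_suml.
    over.
  rewrite exchange_big /=; apply: eq_bigr => x _; rewrite rmorph_sum; apply: eq_bigr => y _.
  rewrite !mxE !enum_rankK !rmorphM /= rmorph_nat; ring.
rewrite mxE (reindex _ (onW_bij _ (@enum_rank_bij T))) /=; apply: eq_bigr => x _.
by rewrite !mxE enum_rankK rmorphXn /= expr2.
Qed.

End Spectral.

Section Forbidden.
Variables (T : finType) (e : rel T) (m : nat).
Hypothesis e_sym : symmetric e.
Hypothesis e_irr : irreflexive e.
Hypothesis m_gt0 : 0 < m.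
Hypothesis ge_m : forall a : algC, eigenvalue (adjmx e) a -> (- (m%:R) <= a)%R.

Definition nb x S : nat := #|nbhd e x :&: S|.

Section Ring.
Local Open Scope ring_scope.

Lemma sum_ind (S : {set T}) (a : int) : \sum_x a * (x \in S)%:R = a * #|S|%:R.
Proof.
rewrite -mulr_sumr -sum1_card natr_sum [in RHS]big_mkcond /=; congr (_ * _).
by apply: eq_bigr => x _; case: (x \in S).
Qed.

Lemma sum_nb (S : {set T}) (a : int) x : \sum_y (e x y)%:R * (a * (y \in S)%:R) = a * (nb x S)%:R.
Proof.
rewrite -sum_ind; apply: eq_bigr => y _.
by rewrite !inE; case: (e x y); rewrite ?mul1r // mul0r mulr0.
Qed.

Lemma form_ge (v : T -> int) :
  0 <= \sum_x v x * (\sum_y (e x y)%:R * v y + m%:R * v x).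
Proof.
have := adjacency_form_ge v e_sym ge_m; congr (0 <= _).
rewrite mulr_sumr -big_split; apply: eq_bigr => x _ /=.
by rewrite mulrDr mulr_sumr; congr (_ + _); [apply: eq_bigr => y _|]; ring.
Qed.

End Ring.

(** With weight [- m] at [x] and [1] on [Y] the form equals [m (m^2 - |Y|)]. *)
Lemma claw_free x (Y : {set T}) : Y \subset nbhd e x ->
  (forall y z, y \in Y -> z \in Y -> ~~ e y z) -> #|Y| <= m ^ 2.
Proof.
move=> /subsetP Yx co.
pose v (z : T) : int := (- m%:R * (z \in [set x])%:R + 1 * (z \in Y)%:R)%R.
have := form_ge v; rewrite leqNgt => ge0; apply/negP => lt; move: ge0.
apply/negP; rewrite -ltNge.
have N z : (\sum_y (e z y)%:R * v y = - m%:R * (nb z [set x])%:R + 1 * (nb z Y)%:R :> int)%R.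
  by rewrite -!sum_nb -big_split; apply: eq_bigr => y _ /=; rewrite mulrDr.
have xY : x \notin Y by apply/negP=> /Yx; rewrite inE e_irr.
have nbx : nb x Y = #|Y| by rewrite /nb (setIidPr _) //; apply/subsetP.
have nbxx : nb x [set x] = 0.
  by apply/eqP; rewrite cards_eq0; apply/eqP/setP=> z; rewrite !inE; case: eqP => [->|]; rewrite ?e_irr ?andbF.
have nbYY z : z \in Y -> nb z Y = 0.
  move=> zY; apply/eqP; rewrite cards_eq0; apply/eqP/setP=> w; rewrite !inE.
  by apply/negP=> /andP[ezw wY]; move/negP: (co _ _ zY wY).
have nbYx z : z \in Y -> nb z [set x] = 1.
  move=> zY; rewrite /nb (setIidPr _) ?cards1 // sub1set inE e_sym.
  by have := Yx _ zY; rewrite inE.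
rewrite (eq_bigr (fun z => (- (m%:R * (#|Y|%:R - m%:R ^+ 2)) * (z \in [set x])%:R)%R)) => [|z _].
  rewrite sum_ind cards1; nia.
rewrite N /v !inE; case: eqP => [->|_].
  by rewrite nbx nbxx (negbTE xY); nia.
case: (boolP (z \in Y)) => [zY|_]; last by nia.
by rewrite nbYY ?nbYx //; nia.
Qed.

Let r := (m ^ 2).+1.

(** With weights [m r] at [y], [r] on [Y] and [- 1] on [C] the form is at most [- r^2 (r + 1)].
    Edges inside [Y] are allowed: a vertex of [Y] has at most [r - 1] neighbours there. *)
Lemma clique_coneighbours y (Y C : {set T}) : clique e C ->
  #|C| = r ^ 2 -> #|Y| = r -> y \notin Y -> (forall z, z \in Y -> ~~ e y z) ->
  C \subset nbhd e y -> (forall z, z \in Y -> C \subset nbhd e z) -> False.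
Proof.
move=> cl cC cY yY co /subsetP Cy YC.
pose v (z : T) : int := ((m * r)%:R * (z \in [set y])%:R + r%:R * (z \in Y)%:R
   + (- 1) * (z \in C)%:R)%R.
have N z : (\sum_w (e z w)%:R * v w = (m * r)%:R * (nb z [set y])%:R + r%:R * (nb z Y)%:R
   + (- 1) * (nb z C)%:R :> int)%R.
  by rewrite -!sum_nb -!big_split; apply: eq_bigr => w _ /=; rewrite !mulrDr.
have yC : y \notin C by apply/negP=> /Cy; rewrite inE e_irr.
have YC' z : z \in Y -> z \notin C.
  by move=> zY; apply/negP=> /(subsetP (YC _ zY)); rewrite inE e_irr.
have nbyy : nb y [set y] = 0.
  by apply/eqP; rewrite cards_eq0; apply/eqP/setP=> z; rewrite !inE; case: eqP => [->|]; rewrite ?e_irr ?andbF.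
have nbyY : nb y Y = 0.
  apply/eqP; rewrite cards_eq0; apply/eqP/setP=> w; rewrite !inE.
  by apply/negP=> /andP[ezw wY]; move/negP: (co _ wY).
have nbyC : nb y C = r ^ 2 by rewrite /nb (setIidPr _) //; apply/subsetP.
have nbYy z : z \in Y -> nb z [set y] = 0.
  move=> zY; apply/eqP; rewrite cards_eq0; apply/eqP/setP=> w; rewrite !inE.
  by apply/negP=> /andP[ezw /eqP wy]; move/negP: (co _ zY); rewrite e_sym -wy.
have nbYY z : z \in Y -> nb z Y <= r.-1.
  move=> zY; rewrite -cY (cardsD1 z Y) zY /=; apply: subset_leq_card.
  by apply/subsetP=> w; rewrite !inE => /andP[ezw ->]; rewrite andbT; apply: contraTneq ezw => ->; rewrite e_irr.
have nbYC z : z \in Y -> nb z C = r ^ 2 by move=> zY; rewrite /nb (setIidPr _) //; apply: YC.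
have nbCy z : z \in C -> nb z [set y] = 1.
  move=> zC; rewrite /nb (setIidPr _) ?cards1 // sub1set inE e_sym.
  by have := Cy _ zC; rewrite inE.
have nbCY z : z \in C -> nb z Y = r.
  move=> zC; rewrite /nb (setIidPr _) //; apply/subsetP=> w wY; rewrite inE e_sym.
  by have := subsetP (YC _ wY) _ zC; rewrite inE.
have nbCC z : z \in C -> nb z C = (r ^ 2).-1.
  move=> zC; rewrite -cC (cardsD1 z C) zC /=; apply: eq_card => w; rewrite !inE.
  by case: eqP => [->|/eqP ne]; rewrite ?e_irr //; case wC : (w \in C); rewrite ?andbF // andbT cl // eq_sym.
have := form_ge v; apply/negP; rewrite -ltNge.
have rE : (r%:R = m%:R * m%:R + 1 :> int)%R by rewrite /r; nia.
have r0 : 0 < r by [].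
apply: (@le_lt_trans _ _ (\sum_z (- (m * r ^ 2)%:R * (z \in [set y])%:R +
   (r ^ 2)%:R * (m%:R - 1) * (z \in Y)%:R + (- (1 + m%:R * r%:R - m%:R)) * (z \in C)%:R))%R).
  apply: ler_sum => z _; rewrite N /v !inE.
  case: (eqVneq z y) => [->|_].
    rewrite nbyy nbyY nbyC (negbTE yY) (negbTE yC); nia.
  case: (boolP (z \in Y)) => [zY|_].
    rewrite nbYy // nbYC // (negbTE (YC' _ zY)); have := nbYY _ zY; nia.
  case: (boolP (z \in C)) => [zC|_]; last by nia.
  by rewrite nbCy // nbCY // nbCC //; nia.
rewrite !big_split /= !sum_ind cards1 cC cY; nia.
Qed.

End Forbidden.

(** * Cocliques and Ramsey's theorem *)

Definition coclique (T : finType) (e : rel T) (Y : {set T}) :=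
  forall y z, y \in Y -> z \in Y -> ~~ e y z.

Lemma subset_of_card (T : finType) (A : {set T}) n : n <= #|A| ->
  exists2 B : {set T}, B \subset A & #|B| = n.
Proof.
move=> le; exists [set x in take n (enum A)].
  by apply/subsetP=> x; rewrite inE => /mem_take; rewrite mem_enum.
rewrite cardsE (card_uniqP _) ?take_uniq ?enum_uniq // size_takel //.
by rewrite -cardE.
Qed.

Lemma ramsey (T : finType) (e : rel T) p s (S : {set T}) : symmetric e -> irreflexive e ->
  2 ^ (p + s) <= #|S| ->
  (exists C : {set T}, [/\ C \subset S, clique e C & #|C| = p]) \/
  (exists Y : {set T}, [/\ Y \subset S, coclique e Y & #|Y| = s]).
Proof.
move=> e_sym e_irr; move: {2}(p + s) (erefl (p + s)) => n; elim: n p s S => [|n IH] p s S.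
  move=> /eqP; rewrite addn_eq0 => /andP[/eqP -> /eqP ->] _.
  by left; exists set0; rewrite sub0set cards0; split=> // x y; rewrite inE.
case: p => [|p].
  by left; exists set0; rewrite sub0set cards0; split=> // x y; rewrite inE.
case: s => [|s].
  by right; exists set0; rewrite sub0set cards0; split=> // x y; rewrite inE.
move=> ns le; have ps : p + s.+1 = n by lia.
have ps' : p.+1 + s = n by lia.
have [x xS] : exists x, x \in S by apply/card_gt0P; apply: leq_trans le; rewrite expn_gt0.
have := cardsD1 x S; rewrite xS.
have := cardsID (nbhd e x) (S :\ x); move: le; rewrite ns expnS.
have := expn_gt0 2 n => /= n0 le cI cS.
have [h|h] := leqP (2 ^ n) #|(S :\ x) :&: nbhd e x|.
  have [|[C [CS Cc Cp]]|[Y [YS Yc Ys]]] := IH p s.+1 ((S :\ x) :&: nbhd e x) ps; first by rewrite ps.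
    left; exists (x |: C); split.
    - apply/subsetP=> y; rewrite !inE => /orP[/eqP -> //|/(subsetP CS)].
      by rewrite !inE => /andP[/andP[]].
    - have xC y : y \in C -> e x y by move/(subsetP CS); rewrite !inE => /andP[].
      move=> y z; rewrite !inE => /orP[/eqP ->|yC] /orP[/eqP ->|zC]; rewrite ?eqxx //.
      + by rewrite xC.
      + by rewrite e_sym xC.
      by apply: Cc.
    rewrite cardsU1 Cp; case: (boolP (x \in C)) => // /(subsetP CS).
    by rewrite !inE eqxx.
  right; exists Y; split=> //; apply: subset_trans YS _.
  by apply/subsetP=> y; rewrite !inE => /andP[/andP[]].
have [|[C [CS Cc Cp]]|[Y [YS Yc Ys]]] := IH p.+1 s ((S :\ x) :\: nbhd e x) ps'.
- rewrite ps'; lia.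
- left; exists C; split=> //; apply: subset_trans CS _.
  by apply/subsetP=> y; rewrite !inE => /andP[_ /andP[]].
right; exists (x |: Y); split.
- apply/subsetP=> y; rewrite !inE => /orP[/eqP -> //|/(subsetP YS)].
  by rewrite !inE => /andP[_ /andP[]].
- have xY y : y \in Y -> ~~ e x y by move=> /(subsetP YS); rewrite !inE => /andP[].
  move=> y z; rewrite !inE => /orP[/eqP ->|yY] /orP[/eqP ->|zY]; rewrite ?e_irr //.
  + by rewrite xY.
  + by rewrite e_sym xY.
  by apply: Yc.
rewrite cardsU1 Ys; case: (boolP (x \in Y)) => // /(subsetP YS).
by rewrite !inE eqxx andbF.
Qed.

(** * Few vertices share a large common neighbourhood with a given non-neighbour *)

Section Mu.
Variables (T : finType) (e : rel T) (r : nat).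
Hypothesis e_sym : symmetric e.
Hypothesis e_irr : irreflexive e.
Hypothesis r_gt1 : 1 < r.
Hypothesis claw : forall x (Y : {set T}), Y \subset nbhd e x -> coclique e Y -> #|Y| < r.
Hypothesis coneigh : forall y (Y C : {set T}), clique e C ->
  #|C| = r ^ 2 -> #|Y| = r -> y \notin Y -> (forall z, z \in Y -> ~~ e y z) ->
  C \subset nbhd e y -> (forall z, z \in Y -> C \subset nbhd e z) -> False.
Notation nb := (nb e).

Lemma clique_sub (C D : {set T}) : D \subset C -> clique e C -> clique e D.
Proof. by move=> /subsetP DC Cc x y /DC xC /DC yC; apply: Cc. Qed.

(** [r] non-neighbours and [r ^ 2] neighbours of [y] inside [C] would form the configuration
    excluded by [coneigh]. *)
Lemma few_nonneighbours y (C : {set T}) : clique e C -> y \notin C -> r ^ 2 <= nb y C ->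
  #|C :\: nbhd e y| < r.
Proof.
move=> Cc yC /subset_of_card[D DC Dr]; rewrite ltnNge; apply/negP.
move=> /subset_of_card[Y YC Yr]; apply: (@coneigh y Y D) => //.
- by apply: clique_sub Cc; apply: subset_trans DC _; rewrite subsetIr.
- by apply: contra yC => /(subsetP YC); rewrite inE => /andP[].
- by move=> z /(subsetP YC); rewrite !inE => /andP[].
- by apply: subset_trans DC _; rewrite subsetIl.
move=> z zY; apply/subsetP=> w wD; rewrite inE.
have := subsetP YC _ zY; have := subsetP DC _ wD; rewrite !inE => /andP[eyw wC] /andP[eyz zC].
by apply: Cc => //; apply: contraNneq eyz => ->.
Qed.

(** Each such vertex misses fewer than [r] elements of [C] by [few_nonneighbours], so [r] of them
    still have [r ^ 2] common neighbours in [C], against [coneigh]. *)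
Lemma few_conearby y (C : {set T}) : clique e C -> C \subset nbhd e y -> 2 * r ^ 2 <= #|C| ->
  #|[set z | [&& z != y, ~~ e y z & r ^ 2 <= nb z C]]| < r.
Proof.
move=> Cc Cy Cr; rewrite ltnNge; apply/negP => /subset_of_card[Y YP Yr].
have P z : z \in Y -> [/\ z != y, ~~ e y z & r ^ 2 <= nb z C].
  by move=> /(subsetP YP); rewrite inE => /and3P[].
have few z : z \in Y -> #|C :\: nbhd e z| < r.
  move=> /P[zy yz ?]; apply: few_nonneighbours => //.
  by apply: contra yz => /(subsetP Cy); rewrite inE.
pose B := \bigcup_(z in Y) (C :\: nbhd e z).
have leB : #|B| <= r ^ 2.
  apply: leq_trans (card_bigcup_le _ _) _; rewrite -mulnn -{1}Yr -sum_nat_const.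
  by apply: leq_sum => z /few /ltnW.
have : r ^ 2 <= #|C :\: B| by have := cardsID B C; have := subset_leq_card (subsetIr C B); lia.
case/subset_of_card => D DC Dr; apply: (@coneigh y Y D) => //.
- by apply: clique_sub Cc; apply: subset_trans DC _; rewrite subsetDl.
- by apply/negP=> /P[]; rewrite eqxx.
- by move=> z /P[].
- by apply: subset_trans DC _; apply: subset_trans Cy; rewrite subsetDl.
move=> z zY; apply/subsetP=> w /(subsetP DC); rewrite !inE => /andP[wB wC].
apply: contraNT wB => ezw; apply/bigcupP; exists z => //.
by rewrite !inE ezw wC.
Qed.

(** A greedy step below discards at most [r^2 (r + r^2) + r^3 = r^4 + 2 r^3] vertices of a clique of
    this size. *)
Let p := r ^ 4 + 2 * r ^ 3 + 2 * r ^ 2 + 2.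

(** Greedy construction of a coclique of [r] neighbours of [x]: [I] is extended by a vertex of
    [f z1] after dropping the few [z] with many neighbours in [f z1]. *)
Lemma no_spread_cliques x (f : T -> {set T}) n (Z I : {set T}) :
  (forall z, z \in Z -> [/\ z != x, ~~ e x z, clique e (f z), #|f z| = p
     & f z \subset nbhd e x :&: nbhd e z]) ->
  n * r <= #|Z| -> I \subset nbhd e x -> coclique e I -> #|I| + n = r ->
  (forall z i, z \in Z -> i \in I -> nb i (f z) < r ^ 2) -> False.
Proof.
have pr : 2 * r ^ 2 <= p by rewrite /p; nia.
elim: n Z I => [|n IH] Z I fP nZ Ix Ic In Inb.
  by have := claw Ix Ic; rewrite -In addn0 ltnn.
have [Z0 Z0Z cZ0] := subset_of_card nZ.
have [z1 z1Z0] : exists z1, z1 \in Z0 by apply/card_gt0P; rewrite cZ0 muln_gt0 /= ltnW.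
have z1Z := subsetP Z0Z _ z1Z0.
have [z1x xz1 f1c f1p f1s] := fP _ z1Z.
have [f1x f1z] : f z1 \subset nbhd e x /\ f z1 \subset nbhd e z1.
  by move: f1s; rewrite subsetI => /andP[].
pose Z' := [set z in Z0 | nb z (f z1) < r ^ 2].
have Z'Z : Z' \subset Z by apply: subset_trans Z0Z; apply/subsetP=> z; rewrite inE => /andP[].
have cZ' : n * r <= #|Z'|.
  have : #|Z0 :\: Z'| < r.
    apply: leq_ltn_trans (few_conearby f1c f1x _); last by rewrite f1p.
    apply: subset_leq_card; apply/subsetP=> z; rewrite !inE => /andP[h zZ0].
    have [-> -> _ _ _] := fP _ (subsetP Z0Z _ zZ0).
    by move: h; rewrite zZ0 /= -leqNgt.
  have := cardsID Z' Z0; have := subset_leq_card (subsetIr Z0 Z').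
  rewrite cZ0 mulSn; clear; lia.
(* [B1] collects the choices of [c] that would break the last hypothesis for some [z] in [Z']:
   either neighbours of [z], few by definition of [Z'], or non-neighbours, few by [few_conearby].
   [B2] collects the neighbours of [I]. *)
pose B1 := \bigcup_(z in Z') [set c in f z1 | r ^ 2 <= nb c (f z)].
pose B2 := \bigcup_(i in I) (nbhd e i :&: f z1).
have cB1 : #|B1| <= r ^ 2 * (r + r ^ 2).
  apply: leq_trans (card_bigcup_le _ _) _.
  apply: (@leq_trans (\sum_(z in Z') (r + r ^ 2))); last first.
    rewrite sum_nat_const leq_mul2r; apply/orP; right.
    have : #|Z'| <= #|Z0| by apply: subset_leq_card; apply/subsetP=> z; rewrite inE => /andP[].
    move=> le; apply: leq_trans le _; rewrite cZ0 -mulnn leq_mul2r -In leq_addl orbT //.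
  apply: leq_sum => z zZ'; have [zx xz fc fp fs] := fP _ (subsetP Z'Z _ zZ').
  have fz : f z \subset nbhd e z by move: fs; rewrite subsetI => /andP[].
  apply: (@leq_trans #|[set c | [&& c != z, ~~ e z c & r ^ 2 <= nb c (f z)]] :|: (nbhd e z :&: f z1)|).
    apply: subset_leq_card; apply/subsetP=> c; rewrite !inE => /andP[cf1 ->].
    rewrite cf1 !andbT; case: (boolP (e z c)) => _; rewrite ?orbT //= ?andbT ?orbF.
    by apply: contraNneq xz => <-; have := subsetP f1x _ cf1; rewrite inE.
  apply: leq_trans (leq_card_setU _ _) _; apply: leq_add.
    by apply: ltnW; apply: few_conearby => //; rewrite fp.
  by move: zZ'; rewrite inE => /andP[_ /ltnW].
have cB2 : #|B2| <= r * r ^ 2.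
  apply: leq_trans (card_bigcup_le _ _) _.
  apply: (@leq_trans (\sum_(i in I) r ^ 2)); last by rewrite sum_nat_const leq_mul2r -{2}In leq_addr orbT.
  by apply: leq_sum => i iI; apply: ltnW; apply: Inb.
have [c cf] : exists2 c, c \in f z1 & c \notin B1 :|: B2.
  apply: exists_setD; rewrite f1p; apply: leq_ltn_trans (leq_card_setU _ _) _.
  by apply: leq_ltn_trans (leq_add cB1 cB2) _; rewrite /p; clear; nia.
rewrite inE negb_or => /andP[cB1' cB2'].
have cI i : i \in I -> ~~ e i c.
  by move=> iI; apply: contra cB2' => eic; apply/bigcupP; exists i; rewrite // !inE eic.
apply: (IH Z' (c |: I)) => //.
- by move=> z /(subsetP Z'Z) /fP.
- by rewrite subUset sub1set (subsetP f1x).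
- move=> y z; rewrite !inE => /orP[/eqP ->|yI] /orP[/eqP ->|zI]; rewrite ?e_irr //.
  + by rewrite e_sym cI.
  + by rewrite cI.
  by apply: Ic.
(* An element of the clique [f z1] has [p - 1] neighbours in it, too many for an element of [I]. *)
- suff cI' : c \notin I by rewrite cardsU1 cI' add1n addSnnS.
  apply/negP=> cI'; have := Inb _ _ z1Z cI'; apply/negP; rewrite -leqNgt.
  have -> : nb c (f z1) = #|f z1|.-1.
    rewrite [in RHS](cardsD1 c) cf /=; apply: eq_card => w; rewrite !inE.
    by case: eqP => [->|/eqP ne]; rewrite ?e_irr //; case wC : (w \in f z1); rewrite ?andbF // andbT f1c // eq_sym.
  by rewrite f1p /p; clear; nia.
move=> z i zZ'; rewrite !inE => /orP[/eqP ->|]; last by apply: Inb; apply: (subsetP Z'Z).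
rewrite ltnNge; apply: contra cB1' => h; apply/bigcupP; exists z => //.
by rewrite inE cf.
Qed.

(** Neighbourhoods contain no coclique of size [r], so Ramsey's theorem finds a [p]-clique in each
    common neighbourhood, and [no_spread_cliques] starts from the empty coclique. *)
Lemma card_large_common_lt x (Z : {set T}) :
  (forall z, z \in Z -> [/\ z != x, ~~ e x z & 2 ^ (p + r) <= #|nbhd e x :&: nbhd e z|]) ->
  #|Z| < r ^ 2.
Proof.
move=> ZP; rewrite ltnNge; apply/negP => cZ.
have ex z : z \in Z -> exists C : {set T}, [&& C \subset nbhd e x :&: nbhd e z,
   [forall u in C, forall v in C, (u != v) ==> e u v] & #|C| == p].
  move=> /ZP[_ _ /(ramsey e_sym e_irr)[[C [Cs Cc /eqP Cp]]|[Y [Ys Yc Yr]]]].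
    exists C; rewrite Cs Cp andbT /=; apply/forall_inP => u uC; apply/forall_inP => v vC.
    by apply/implyP; apply: Cc.
  have : #|Y| < r by apply: (claw (x := x)) => //; apply: subset_trans Ys _; rewrite subsetIl.
  by rewrite Yr ltnn.
(* The default [set0] is never taken on [Z], by [ex]. *)
pose f z := odflt set0 [pick C : {set T} | [&& C \subset nbhd e x :&: nbhd e z,
   [forall u in C, forall v in C, (u != v) ==> e u v] & #|C| == p]].
apply: (@no_spread_cliques x f r Z set0).
- move=> z zZ; have [zx xz _] := ZP _ zZ; rewrite /f; case: pickP => [C|no] /=; last first.
    by have [C] := ex _ zZ; rewrite no.
  case/and3P=> Cs /forall_inP Cc /eqP Cp; split=> // u v uC vC ne.
  by have /forall_inP/(_ v vC)/implyP/(_ ne) := Cc _ uC.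
- by rewrite mulnn.
- exact: sub0set.
- by move=> y z; rewrite inE.
- by rewrite cards0.
by move=> z i _; rewrite inE.
Qed.

End Mu.

(** * Common neighbours, and graphs whose complement has small valency *)

Section Common.
Variables (T : finType) (e : rel T).
Hypothesis e_sym : symmetric e.
Hypothesis e_irr : irreflexive e.
Hypothesis e_dr : distance_regular e.
Notation d := (gdist e).
Let e_conn : gconnected e := proj1 e_dr.

Definition common x y := nbhd e x :&: nbhd e y.

Lemma c_num2 x y : d x y = 2 -> c_num e x y = #|common x y|.
Proof.
move=> dxy; rewrite /c_num dxy; apply: eq_card => z.
by rewrite !inE (gdist_eq1 e_conn e_irr) andbC.
Qed.

Lemma gdist_gt1 x y : x != y -> ~~ e x y -> 1 < d x y.
Proof.
move=> xy exy; rewrite ltn_neqAle lt0n (gdist_eq0 e_conn) xy andbT eq_sym.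
by rewrite (gdist_eq1 e_conn e_irr).
Qed.

Lemma gdist_eq2 x y z : x != y -> ~~ e x y -> e x z -> e z y -> d x y = 2.
Proof.
move=> xy exy exz ezy; have := gdist_gt1 xy exy.
have := gdist_triangle e_conn z x y.
have := gdist_edge e_conn exz; have := gdist_edge e_conn ezy; lia.
Qed.

Lemma card_common_edge x y : e x y -> #|common x y| + 1 + b_num e x y = deg e y.
Proof.
move=> exy; have /eqP d1 : d x y == 1 by rewrite gdist_eq1.
rewrite /deg -(cardsID (nbhd e x) (nbhd e y)) /common setIC -addnA; congr (_ + _).
rewrite [in RHS](cardsD1 x) !inE e_irr e_sym exy /=; congr (_ + _).
apply: eq_card => z; rewrite !inE d1; case: (boolP (e y z)) => [eyz|]; last by rewrite !andbF.
rewrite andbT /=; apply/eqP/andP => [dz|[zx xz]].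
  by rewrite -(gdist_eq1 e_conn e_irr) dz -(gdist_eq0 e_conn) gdist_sym // dz.
by apply: (gdist_eq2 (z := y)); rewrite // eq_sym.
Qed.

Lemma card_common_regular x y x' y' : e x y -> e x' y' -> #|common x y| = #|common x' y'|.
Proof.
move=> exy exy'; have := card_common_edge exy; have := card_common_edge exy'.
have -> : b_num e x y = b_num e x' y'.
  apply: (proj2 (proj2 e_dr x y x' y' _)).
  by have /eqP -> : d x y == 1; [rewrite gdist_eq1|have /eqP -> : d x' y' == 1; rewrite ?gdist_eq1].
rewrite (deg_regular e_irr e_dr y y'); lia.
Qed.

Definition dist2_set x := [set y | d x y == 2].

Lemma not_complete_dist2 : ~ complete_graph e -> exists x y, d x y = 2.
Proof.
move=> nc; have [/existsP[x /existsP[y /eqP]]|/existsPn h] :=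
  boolP [exists x, exists y, d x y == 2]; first by exists x, y.
case: nc => x y xy; apply/negPn/negP => exy; have := gdist_gt1 xy exy.
move=> /(geodesic e_sym e_dr)[z dz _].
by have /existsPn/(_ z) := h x; rewrite dz.
Qed.

(** Adjacent vertices all have the same number of common non-neighbours, which is positive because
    the complement is connected; so the complement has diameter at most 2 and valency at most [K]. *)
Lemma card_dense K : coconnected e -> ~ complete_graph e ->
  (forall x, #|dist2_set x| <= K) ->
  (forall x y, d x y = 2 -> K < #|common x y|) -> #|T| <= 1 + K + K * K.
Proof.
move=> co nc leK muK.
(* On a geodesic [x], [w], [y'], [z] of length 3, the more than [K] common neighbours of [w] and [z]
   would all be at distance 2 from [x]. *)
have diam2 x y : d x y <= 2.
  rewrite leqNgt; apply/negP => /(geodesic e_sym e_dr)[z dz _].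
  have [y' ey' dy'] := gdist_pred e_sym e_conn dz.
  have [w ew dw] := gdist_pred e_sym e_conn dy'.
  have wz : d w z = 2.
    have := gdist_triangle e_conn w x z; have := gdist_triangle e_conn y' w z.
    have := gdist_edge e_conn ew; have := gdist_edge e_conn ey'; lia.
  have := leq_ltn_trans (leK x) (muK _ _ wz); rewrite ltnNge => /negP; apply.
  apply: subset_leq_card; apply/subsetP=> u; rewrite !inE => /andP[ewu ezu].
  have [] := gdist_step e_sym e_conn x ewu; have [] := gdist_step e_sym e_conn x ezu.
  by rewrite dw dz => *; apply/eqP; lia.
have nadj x y : x != y -> ~~ e x y -> y \in dist2_set x.
  by move=> xy exy; rewrite inE eqn_leq diam2 gdist_gt1.
pose nn x y := ~: (nbhd e x :|: nbhd e y).
have nnE x y x' y' : e x y -> e x' y' -> #|nn x y| = #|nn x' y'|.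
  move=> exy exy'; apply: (@addnI #|nbhd e x :|: nbhd e y|).
  rewrite cardsC; have := cardsC (nbhd e x' :|: nbhd e y').
  have := cardsUI (nbhd e x) (nbhd e y); have := cardsUI (nbhd e x') (nbhd e y').
  have := card_common_regular exy exy'; rewrite /common /nn.
  have := deg_regular e_irr e_dr x x'; have := deg_regular e_irr e_dr y y'; rewrite /deg; lia.
(* Otherwise non-adjacency is transitive, and a path in the complement between the ends of an edge
   makes them non-adjacent. *)
have [u [w [z [euw euz ewz]]]] : exists u w z, [/\ e u w, ~~ e u z & ~~ e w z].
  have [/existsP[u /existsP[w /existsP[z /and3P[*]]]]|no] :=
    boolP [exists u, exists w, exists z, [&& e u w, ~~ e u z & ~~ e w z]].
    by exists u, w, z.
  have tr u w z : ~~ e u z -> ~~ e z w -> ~~ e u w.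
    move=> uz zw; apply/negP => uw; move/existsPn: no => /(_ u)/existsPn/(_ w)/existsPn/(_ z).
    by rewrite uw uz e_sym zw.
  have [x [y dxy]] := not_complete_dist2 nc.
  have [v evy _] := gdist_pred e_sym e_conn dxy.
  have /connectP[s sP sl] := co v y.
  suff : ~~ e v (last v s) by rewrite -sl evy.
  elim: s {sl} (v) sP => [|a s IH] b /=; first by rewrite e_irr.
  by case/andP=> /andP[_ eba] /IH; apply: tr.
have nn0 : 0 < #|nn u w| by apply/card_gt0P; exists z; rewrite !inE negb_or euz ewz.
have cover : [set: T] \subset [set u] :|: dist2_set u :|:
    \bigcup_(a in dist2_set u) dist2_set a.
  apply/subsetP=> y _; rewrite !inE; have [//|yu] := eqVneq y u.
  case: (boolP (e u y)) => [euy|euy]; last first.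
    by have := nadj u y; rewrite eq_sym yu euy inE => ->.
  have /card_gt0P[a] : 0 < #|nn u y| by rewrite (nnE _ _ _ _ euy euw).
  rewrite !inE negb_or => /andP[ua ya]; apply/orP; right.
  apply/bigcupP; exists a; apply: nadj => //.
  - by apply: contraNneq ya => <-; rewrite e_sym.
  - by apply: contraNneq ua => ->.
  by rewrite e_sym.
rewrite -cardsT; apply: leq_trans (subset_leq_card cover) _.
apply: leq_trans (leq_card_setU _ _) _; apply: leq_add.
  apply: leq_trans (leq_card_setU _ _) _; rewrite cards1 leq_add2l; exact: leK.
apply: leq_trans (card_bigcup_le _ _) _.
apply: (@leq_trans (\sum_(a in dist2_set u) K)); first by apply: leq_sum.
by rewrite sum_nat_const leq_mul2r leK orbT.
Qed.

End Common.

(** * Lines *)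

Section Lines.
Variables (T : finType) (e : rel T) (lam c q k : nat).
Hypothesis e_sym : symmetric e.
Hypothesis e_irr : irreflexive e.
Hypothesis lamE : forall x y, e x y -> #|common e x y| = lam.
Hypothesis mu_le : forall x y, x != y -> ~~ e x y -> #|common e x y| <= c.
Hypothesis claw : forall x (Y : {set T}), Y \subset nbhd e x -> coclique e Y -> #|Y| <= q.
Hypothesis degE : forall x, deg e x = k.
Hypothesis lam_big : 2 * q.+1 * q.+1 * c.+1 <= lam.

Definition cocliqueb x (I : {set T}) :=
  (I \subset nbhd e x) && [forall y in I, forall z in I, ~~ e y z].

Lemma cocliqueP x (I : {set T}) : reflect (I \subset nbhd e x /\ coclique e I) (cocliqueb x I).
Proof.
apply: (iffP andP) => -[Ix h]; split=> //.
  by move=> y z yI zI; move/forall_inP: h => /(_ y yI)/forall_inP/(_ z zI).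
by apply/forall_inP => y yI; apply/forall_inP => z zI; apply: h.
Qed.

Lemma max_coclique x : exists2 I : {set T}, I \subset nbhd e x /\ coclique e I &
  forall J : {set T}, J \subset nbhd e x -> coclique e J -> #|J| <= #|I|.
Proof.
have P0 : cocliqueb x set0.
  by apply/cocliqueP; rewrite sub0set; split=> // y z; rewrite inE.
case: (arg_maxnP (fun I : {set T} => #|I|) P0) => I /cocliqueP[Ix Ic] mx.
by exists I => // J Jx Jc; apply: mx; apply/cocliqueP.
Qed.

Lemma max_coclique_adj x (I : {set T}) z : I \subset nbhd e x -> coclique e I ->
  (forall J : {set T}, J \subset nbhd e x -> coclique e J -> #|J| <= #|I|) ->
  e x z -> z \notin I -> exists2 i, i \in I & e i z.
Proof.
move=> Ix Ic mx exz zI; have [/exists_inP[i iI eiz]|no] := boolP [exists i in I, e i z].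
  by exists i.
have ne i : i \in I -> ~~ e i z.
  by move=> iI; apply: contra no => eiz; apply/exists_inP; exists i.
have := mx (z |: I); rewrite cardsU1 zI add1n ltnn => h; suff : false by []; apply: h.
  by rewrite subUset sub1set inE exz.
move=> a b; rewrite !inE => /orP[/eqP ->|aI] /orP[/eqP ->|bI]; rewrite ?e_irr //.
- by rewrite e_sym ne.
- exact: ne.
exact: Ic.
Qed.

(** A maximum coclique in the neighbourhood of [x] dominates it and has at most [q] elements. Hence
    a large valency forces a large [lam]. *)
Lemma valency_le (x : T) : k <= q * lam.+1.
Proof.
have [I [Ix Ic] mx] := max_coclique x.
have sub : nbhd e x \subset \bigcup_(i in I) (i |: common e x i).
  apply/subsetP=> z; rewrite inE => exz; case: (boolP (z \in I)) => [zI|zI].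
    by apply/bigcupP; exists z; rewrite // !inE eqxx.
  have [i iI eiz] := max_coclique_adj Ix Ic mx exz zI.
  by apply/bigcupP; exists i; rewrite // !inE exz eiz orbT.
rewrite -(degE x); apply: leq_trans (subset_leq_card sub) _.
apply: leq_trans (card_bigcup_le _ _) _.
apply: (@leq_trans (\sum_(i in I) lam.+1)).
  apply: leq_sum => i iI; have exi : e x i by have := subsetP Ix _ iI; rewrite inE.
  by rewrite cardsU1 lamE // -add1n leq_add2r leq_b1.
by rewrite sum_nat_const leq_mul2r (claw Ix Ic) orbT.
Qed.

Definition petal x (I : {set T}) i :=
  i |: [set z in common e x i | [forall j in I, (j != i) ==> ~~ e j z]].

Lemma petalP x (I : {set T}) i z : z \in petal x I i -> z != i ->
  [/\ e x z, e i z & forall j, j \in I -> j != i -> ~~ e j z].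
Proof.
rewrite !inE => /orP[/eqP -> |/andP[/andP[exz eiz] /forall_inP h]]; first by rewrite eqxx.
by move=> _; split=> // j jI /(implyP (h _ jI)).
Qed.

(** Replacing [i] by two non-adjacent vertices of its petal would give a larger coclique. *)
Lemma petal_clique x (I : {set T}) i : I \subset nbhd e x -> coclique e I ->
  (forall J : {set T}, J \subset nbhd e x -> coclique e J -> #|J| <= #|I|) ->
  i \in I -> clique e (petal x I i).
Proof.
move=> Ix Ic mx iI a b aP bP ab.
have [ai|ai] := eqVneq a i.
  by have [] := petalP bP _; rewrite -?ai // eq_sym.
have [bi|bi] := eqVneq b i; first by have [_ ia _] := petalP aP ai; rewrite e_sym bi.
have [xa ia aI] := petalP aP ai; have [xb ib bI] := petalP bP bi.
apply/negPn/negP => eab.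
have ani z : e i z -> z \notin I by move=> iz; apply/negP => zI; have := Ic _ _ iI zI; rewrite iz.
have := mx (a |: (b |: (I :\ i))).
have -> : #|a |: (b |: (I :\ i))| = #|I|.+1.
  rewrite !cardsU1 !inE (negbTE ab) (negbTE (ani _ ia)) (negbTE (ani _ ib)) !andbF /=.
  by rewrite (cardsD1 i I) iI.
rewrite ltnn => h; suff : false by []; apply: h.
  rewrite !subUset !sub1set !inE xa xb /=; apply: subset_trans Ix; exact: subsetDl.
move=> y z; rewrite !inE => /orP[/eqP ->|/orP[/eqP ->|/andP[yi yI]]]
   /orP[/eqP ->|/orP[/eqP ->|/andP[zi zI]]]; rewrite ?e_irr //.
- by rewrite e_sym aI.
- by rewrite e_sym.
- by rewrite e_sym bI.
- by rewrite aI.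
- by rewrite bI.
exact: Ic.
Qed.

(** A common neighbour of [x] and [i] outside the petal is also adjacent to another [j] in [I], and
    each such [j] accounts for at most [c] of them. *)
Lemma petal_card x (I : {set T}) i : I \subset nbhd e x -> coclique e I -> i \in I ->
  lam.+1 <= #|petal x I i| + q * c.
Proof.
move=> Ix Ic iI; have exi : e x i by have := subsetP Ix _ iI; rewrite inE.
pose P := [set z in common e x i | [forall j in I, (j != i) ==> ~~ e j z]].
have iP : i \notin P by rewrite !inE e_irr andbF.
have -> : #|petal x I i| = #|P|.+1 by rewrite cardsU1 iP.
rewrite -(lamE exi) addSn ltnS -(cardsID P); apply: leq_add.
  by apply: subset_leq_card; exact: subsetIr.
have sub : common e x i :\: P \subset \bigcup_(j in I :\ i) common e i j.
  apply/subsetP=> z; rewrite !inE => /andP[]; case: (boolP (e x z && e i z)) => //= /andP[xz iz] h _.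
  move: h; rewrite negb_forall_in => /exists_inP[j jI]; rewrite negb_imply negbK => /andP[ji jz].
  by apply/bigcupP; exists j; rewrite !inE ?ji ?iz.
apply: leq_trans (subset_leq_card sub) _; apply: leq_trans (card_bigcup_le _ _) _.
apply: (@leq_trans (\sum_(j in I :\ i) c)).
  apply: leq_sum => j; rewrite !inE => /andP[ji jI]; apply: mu_le; last exact: Ic.
  by rewrite eq_sym.
rewrite sum_nat_const leq_mul2r; apply/orP; right.
apply: leq_trans (claw Ix Ic); apply: subset_leq_card; exact: subsetDl.
Qed.

(** The petals over a maximum coclique of neighbours of [x] cover all but boundedly many neighbours
    of [x], so [y] has more than [c] neighbours in one of them, and hence is joined to all of it. *)
Lemma large_clique x y : e x y ->
  exists C : {set T}, [/\ clique e C, x \in C, y \in C & lam + 2 - c * q <= #|C|].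
Proof.
move=> exy; have [I [Ix Ic] mx] := max_coclique x; have Iq := claw Ix Ic.
(* If every petal met the neighbourhood of [y] in at most [c] vertices, the edge [x y] would have at
   most [q c + q^2 c < lam] common neighbours. *)
have [i iI ci] : exists2 i, i \in I & c < #|petal x I i :&: nbhd e y|.
  apply/exists_inP; apply: contraLR lam_big; rewrite negb_exists_in => /forall_inP h.
  rewrite -ltnNge -(lamE exy).
  have sub : common e x y \subset \bigcup_(i in I) (petal x I i :&: nbhd e y)
      :|: \bigcup_(i in I) \bigcup_(j in I :\ i) common e i j.
    apply/subsetP=> z; rewrite !inE => /andP[xz yz]; case: (boolP (z \in I)) => zI.
      by apply/orP; left; apply/bigcupP; exists z; rewrite // !inE eqxx.
    have [j jI jz] := max_coclique_adj Ix Ic mx xz zI.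
    have [/exists_inP[a aI /andP[aj az]]|no] := boolP [exists a in I, (a != j) && e a z].
      apply/orP; right; apply/bigcupP; exists j => //; apply/bigcupP; exists a; rewrite ?inE ?aj //.
      by rewrite jz.
    apply/orP; left; apply/bigcupP; exists j; rewrite // !inE xz jz yz andbT /=.
    apply/orP; right; apply/forall_inP => a aI; apply/implyP => aj.
    by apply: contra no => az; apply/exists_inP; exists a; rewrite ?aj.
  apply: leq_ltn_trans (subset_leq_card sub) _; apply: leq_ltn_trans (leq_card_setU _ _) _.
  have h1 : #|\bigcup_(i in I) (petal x I i :&: nbhd e y)| <= q * c.
    apply: leq_trans (card_bigcup_le _ _) _; apply: (@leq_trans (\sum_(i in I) c)).
      by apply: leq_sum => i iI; have := h i iI; rewrite -leqNgt.
    by rewrite sum_nat_const leq_mul2r Iq orbT.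
  have h2 : #|\bigcup_(i in I) \bigcup_(j in I :\ i) common e i j| <= q * (q * c).
    apply: leq_trans (card_bigcup_le _ _) _; apply: (@leq_trans (\sum_(i in I) (q * c))).
      apply: leq_sum => i iI; apply: leq_trans (card_bigcup_le _ _) _.
      apply: (@leq_trans (\sum_(j in I :\ i) c)).
        apply: leq_sum => j; rewrite !inE => /andP[ji jI]; apply: mu_le; last exact: Ic.
        by rewrite eq_sym.
      rewrite sum_nat_const leq_mul2r; apply/orP; right.
      by apply: leq_trans Iq; apply: subset_leq_card; exact: subsetDl.
    by rewrite sum_nat_const leq_mul2r Iq orbT.
  apply: leq_ltn_trans (leq_add h1 h2) _; clear; nia.
have Pc := petal_clique Ix Ic mx iI; have Pq := petal_card Ix Ic iI.
have yP z : z \in petal x I i -> z != y -> e y z.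
  move=> zP zy; apply/negPn/negP => yz; rewrite eq_sym in zy; have := mu_le zy yz.
  rewrite leqNgt => /negP; apply; apply: leq_trans ci _; apply: subset_leq_card.
  apply/subsetP=> w /setIP[wP]; rewrite inE => yw; rewrite !inE yw /=.
  by apply: Pc => //; apply: contraNneq yz => ->.
have xP z : z \in petal x I i -> e x z.
  move=> zP; have [->|zi] := eqVneq z i; first by have := subsetP Ix _ iI; rewrite inE.
  by have [] := petalP zP zi.
have xnP : x \notin petal x I i by apply/negP => /xP; rewrite e_irr.
move: (petal x I i) Pc Pq yP xP xnP {ci} => P Pc Pq yP xP xnP.
exists (x |: (y |: P)); split.
- move=> a b; rewrite !in_setU1 => /orP[/eqP ->|/orP[/eqP ->|aP]] /orP[/eqP ->|/orP[/eqP ->|bP]];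
    rewrite ?eqxx // => ab.
  + exact: xP.
  + by rewrite e_sym.
  + by apply: yP; rewrite // eq_sym.
  + by rewrite e_sym xP.
  + by rewrite e_sym yP.
  exact: Pc.
- by rewrite !inE eqxx.
- by rewrite !inE eqxx !orbT.
have xy : x != y by apply: contraTneq exy => ->; rewrite e_irr.
have /subset_leq_card : x |: P \subset x |: (y |: P).
  by apply: setUS; exact: subsetUr.
rewrite cardsU1 xnP; move: Pq; rewrite (mulnC q); lia.
Qed.

Definition cliqueb (C : {set T}) := [forall a in C, forall b in C, (a != b) ==> e a b].

Lemma cliqueP C : reflect (clique e C) (cliqueb C).
Proof.
apply: (iffP forall_inP) => h.
  by move=> a b aC bC ab; have /forall_inP/(_ b bC)/implyP := h a aC; apply.
by move=> a aC; apply/forall_inP => b bC; apply/implyP; apply: h.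
Qed.

Definition lines := [set L : {set T} | maxset cliqueb L && (lam + 2 - c * q <= #|L|)].

Lemma line_clique (L : {set T}) : L \in lines -> clique e L.
Proof. by rewrite inE => /andP[/maxsetp/cliqueP]. Qed.

Lemma line_large (L : {set T}) : L \in lines -> lam + 2 - c * q <= #|L|.
Proof. by rewrite inE => /andP[]. Qed.

Lemma clique_le (C : {set T}) x y : clique e C -> x \in C -> y \in C -> x != y -> #|C| <= lam + 2.
Proof.
move=> Cc xC yC xy; have exy := Cc _ _ xC yC xy.
have : #|C :\ x :\ y| <= lam.
  rewrite -(lamE exy); apply: subset_leq_card; apply/subsetP=> z; rewrite !inE.
  by move=> /and3P[zy zx zC]; rewrite !Cc // eq_sym.
rewrite (cardsD1 x C) xC (cardsD1 y (C :\ x)) !inE yC eq_sym xy /=; lia.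
Qed.

Lemma line_exists x y : e x y -> exists2 L, L \in lines & (x \in L) && (y \in L).
Proof.
move=> exy; have [C [Cc xC yC Cl]] := large_clique exy.
have [L Lm CL] : {L | maxset cliqueb L & C \subset L} by apply: maxset_exists; apply/cliqueP.
exists L; last by rewrite !(subsetP CL).
by rewrite inE Lm (leq_trans Cl) ?subset_leq_card.
Qed.

(** If the union is a clique, maximality applies. Otherwise two non-adjacent vertices bound the
    intersection by [c], while the union has at most [lam + 2] elements, too few for two lines. *)
Lemma line_unique x y (L L' : {set T}) : x != y -> L \in lines -> L' \in lines ->
  x \in L -> y \in L -> x \in L' -> y \in L' -> L = L'.
Proof.
move=> xy Ll Ll' xL yL xL' yL'; have Lc := line_clique Ll; have Lc' := line_clique Ll'.
have [/cliqueP Uc|] := boolP (cliqueb (L :|: L')).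
  move: Ll Ll'; rewrite !inE => /andP[/maxsetP[_ mL] _] /andP[/maxsetP[_ mL'] _].
  by rewrite -(mL (L :|: L')) ?subsetUl //; [apply: mL'; rewrite ?subsetUr //|]; apply/cliqueP.
move=> no; exfalso.
have [u [v [uL vL uv euv]]] : exists u v, [/\ u \in L, v \in L', u != v & ~~ e u v].
  move: no; rewrite negb_forall_in => /exists_inP[u uU].
  rewrite negb_forall_in => /exists_inP[v vU]; rewrite negb_imply => /andP[uv euv].
  move: uU vU; rewrite !inE => /orP[uL|uL] /orP[vL|vL].
  - by rewrite Lc in euv.
  - by exists u, v.
  - by exists v, u; rewrite eq_sym e_sym.
  by rewrite Lc' in euv.
have uL' : u \notin L' by apply: contra euv => uL'; apply: Lc'.
have vL' : v \notin L by apply: contra euv => vL'; apply: Lc.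
have cI : #|L :&: L'| <= c.
  apply: leq_trans (mu_le uv euv); apply: subset_leq_card; apply/subsetP=> z.
  rewrite !inE => /andP[zL zL']; rewrite Lc // 1?Lc' //.
    by apply: contraNneq vL' => ->.
  by apply: contraNneq uL' => ->.
have exy : e x y by apply: Lc.
have cU : #|L :|: L'| <= lam + 2.
  have sub : L :|: L' \subset [set x; y] :|: common e x y.
    apply/subsetP=> z; rewrite !inE; case: (eqVneq z x) => //= zx; case: (eqVneq z y) => //= zy.
    by case/orP => zL; rewrite ?(Lc _ _ _ zL) ?(Lc' _ _ _ zL) // eq_sym.
  apply: leq_trans (subset_leq_card sub) _; apply: leq_trans (leq_card_setU _ _) _.
  by rewrite cards2 xy lamE // addnC.
have := line_large Ll; have := line_large Ll'; have := cardsUI L L'.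
move: lam_big cI cU; move: #|L| #|L'| #|_ :|: _| #|_ :&: _| => l1 l2 l3 l4; clear; nia.
Qed.

Lemma one_line x y : e x y -> #|[set L in lines | (x \in L) && (y \in L)]| = 1.
Proof.
move=> exy; have [L Ll xyL] := line_exists exy; have /andP[xL yL] := xyL.
apply/eqP/cards1P; exists L; apply/setP=> L'; rewrite in_set in_set1.
have xy : x != y by apply: contraTneq exy => ->; rewrite e_irr.
apply/andP/eqP => [[L'l /andP[xL' yL']]|->]; last by rewrite Ll.
by apply: (line_unique xy).
Qed.

Definition lines_at x := [set L in lines | x \in L].

Lemma sum_lines_at x : \sum_(L in lines_at x) #|L|.-1 = k.
Proof.
rewrite -(degE x) /deg -sum1_card.
rewrite [RHS](eq_bigr (fun y => \sum_(L in lines_at x) (y \in L))); last first.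
  move=> y; rewrite inE => exy; rewrite -(one_line exy) -sum1dep_card big_mkcond [RHS]big_mkcond.
  rewrite /lines_at; move: lines => Ls.
  by apply: eq_bigr => L _; rewrite in_set; case: (L \in Ls); case: (x \in L); case: (y \in L).
rewrite exchange_big /=; apply: eq_bigr => L; rewrite in_set => /andP[Ll xL].
rewrite (cardsD1 x) xL /= -sum1_card [LHS]big_mkcond [RHS]big_mkcond /=; apply: eq_bigr => y _.
rewrite !inE; have [->|yx] := eqVneq y x; first by rewrite e_irr.
case: (boolP (y \in L)) => [yL|_]; last by case: ifP.
by rewrite (line_clique Ll xL yL) // eq_sym.
Qed.

Lemma line_card (L : {set T}) : L \in lines -> lam + 2 - c * q <= #|L| <= lam + 2.
Proof.
move=> Ll; rewrite line_large //=; have := line_large Ll.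
have [le1|/card_gt1P[x [y [xL yL xy]]] _] := leqP #|L| 1; first by move=> _; apply: leq_trans le1 _; lia.
exact: clique_le (line_clique Ll) xL yL xy.
Qed.

Lemma lines_at_bounds x : #|lines_at x| * (lam.+1 - c * q) <= k <= #|lines_at x| * lam.+1.
Proof.
rewrite -(sum_lines_at x) -!sum_nat_const; apply/andP; split; apply: leq_sum => L;
  rewrite in_set => /andP[/line_card]; lia.
Qed.

Lemma lines_at_le x : #|lines_at x| <= 2 * q.
Proof.
have /andP[h _] := lines_at_bounds x; have := leq_trans h (valency_le x).
move: lam_big; move: #|_| => s; clear; nia.
Qed.

(** [lines_at_bounds] confines [k] to an interval for each number of lines; for distinct numbers up
    to [2 q] these are disjoint, as [lam] is large. *)
Lemma lines_at_const x y : #|lines_at x| = #|lines_at y|.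
Proof.
wlog lt : x y / #|lines_at x| < #|lines_at y|.
  by move=> h; case: (ltngtP #|lines_at x| #|lines_at y|) => // /h ->.
have /andP[hy _] := lines_at_bounds y; have /andP[_ hx] := lines_at_bounds x.
have := leq_trans hy hx; have := lines_at_le x; have := lines_at_le y.
move: lam_big lt; move: #|lines_at x| #|lines_at y| => s s'; clear; nia.
Qed.

(** Incidences are counted twice: a line has more than [2 q] points and a point is on at most [2 q]
    lines. *)
Lemma card_lines_lt : 0 < #|T| -> #|lines| < #|T|.
Proof.
move=> /card_gt0P[x0 _].
have : #|lines| * (lam + 2 - c * q) <= #|T| * (2 * q).
  rewrite -sum_nat_const; apply: (@leq_trans (\sum_(L in lines) #|L|)).
    by apply: leq_sum => L /line_large.
  under eq_bigr do rewrite -sum1_card big_mkcond /=.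
  rewrite exchange_big /=; apply: (@leq_trans (\sum_(x : T) 2 * q)); last by rewrite sum_nat_const.
  apply: leq_sum => x _.
  apply: leq_trans (lines_at_le x).
  suff -> : #|lines_at x| = \sum_(L in lines) (if x \in L then 1 else 0) by [].
  rewrite -sum1_card big_mkcond [RHS]big_mkcond; apply: eq_bigr => L _.
  by rewrite [L \in lines_at x]in_set; case: (L \in lines).
have : 0 < #|T| by apply/card_gt0P; exists x0.
move: lam_big; move: #|lines| #|T| => a b; clear; nia.
Qed.

End Lines.

(** * Delsarte cliques *)

Section Delsarte.
Variables (T : finType) (e : rel T) (CC : {set {set T}}) (s k : nat).
Hypothesis e_sym : symmetric e.
Hypothesis e_irr : irreflexive e.
Hypothesis e_dr : distance_regular e.
Hypothesis line_cl : forall L, L \in CC -> clique e L.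
Hypothesis line1 : forall x y, e x y -> #|[set L in CC | (x \in L) && (y \in L)]| = 1.
Hypothesis linesE : forall x, #|[set L in CC | x \in L]| = s.
Hypothesis lines_lt : #|CC| < #|T|.
Hypothesis line_gt1 : forall L, L \in CC -> 1 < #|L|.
Hypothesis sum_lines : forall x, \sum_(L in [set L in CC | x \in L]) #|L|.-1 = k.
Hypothesis degE : forall x, deg e x = k.
Notation d := (gdist e).
Let e_conn : gconnected e := proj1 e_dr.
Local Open Scope ring_scope.

Section Field.
Variable F : fieldType.

Lemma incidence x y :
  \sum_(L in CC) ((x \in L)%:R * (y \in L)%:R) = (e x y)%:R + s%:R * (x == y)%:R :> F.
Proof.
have -> : \sum_(L in CC) ((x \in L)%:R * (y \in L)%:R) =
   #|[set L in CC | (x \in L) && (y \in L)]|%:R :> F.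
  rewrite -sum1_card natr_sum big_mkcond [RHS]big_mkcond /=; apply: eq_bigr => L _.
  by rewrite inE; case: (L \in CC) => //=; do 2!case: (_ \in L); rewrite /= ?(mul0r, mul1r, mulr0).
have [->|xy] := eqVneq x y.
  rewrite e_irr add0r mulr1 -(linesE y); congr (_%:R).
  by apply: eq_card => L; rewrite !inE andbb.
rewrite mulr0 addr0; case: (boolP (e x y)) => [/line1 -> //|exy].
rewrite (_ : [set _ in _ | _] = set0) ?cards0 //; apply/setP=> L; rewrite !inE.
by apply/negP => /and3P[/line_cl Lc xL yL]; rewrite Lc in exy.
Qed.

(** There are more points than lines, so the incidence matrix has a nonzero left kernel. It is
    needed over [rat] for [radial_kernel] and over [algC] for the eigenvalue. *)
Lemma incidence_kernel : exists2 v : T -> F, exists x, v x != 0 &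
  forall L, L \in CC -> \sum_(x in L) v x = 0.
Proof.
pose N : 'M[F]_(#|T|, #|CC|) := \matrix_(i, j) (enum_val i \in (enum_val j : {set T}))%:R.
have /rowV0Pn[v] : kermx N != 0.
  rewrite kermx_eq0 /row_free neq_ltn (leq_ltn_trans _ lines_lt) //; exact: rank_leq_col.
move=> /sub_kermxP vN v0; exists (fun x => v 0 (enum_rank x)).
  have [i vi] : exists i, v 0 i != 0.
    apply/existsP; apply: contraNT v0 => /existsPn h; apply/eqP/rowP => i; rewrite mxE.
    by apply/eqP; have := h i; rewrite negbK.
  by exists (enum_val i); rewrite enum_valK.
move=> L LC; have := congr1 (fun A : 'rV_ _ => A 0 (enum_rank_in LC L)) vN.
rewrite !mxE (reindex _ (onW_bij _ (@enum_rank_bij T))) /= => {2}<-.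
rewrite big_mkcond; apply: eq_bigr => x _; rewrite mxE enum_rankK enum_rankK_in //.
by case: (x \in L); rewrite ?mulr1 ?mulr0.
Qed.

(** This is [N N^T = A + s I] as a bilinear form, [N] being the point-line incidence matrix. *)
Lemma incidence_form (g h : T -> F) :
  \sum_y h y * (\sum_z g z * ((e z y)%:R + s%:R * (z == y)%:R)) =
  \sum_(L in CC) (\sum_(z in L) g z) * (\sum_(y in L) h y).
Proof.
transitivity (\sum_y \sum_z \sum_(L in CC) (g z * (z \in L)%:R) * (h y * (y \in L)%:R)).
  apply: eq_bigr => y _; rewrite mulr_sumr; apply: eq_bigr => z _.
  rewrite -incidence !mulr_sumr; apply: eq_bigr => L _; ring.
under eq_bigr do rewrite exchange_big /=.
rewrite exchange_big /=; apply: eq_bigr => L _.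
rewrite [X in _ = X * _]big_mkcond [X in _ = _ * X]big_mkcond /= mulrC mulr_suml.
apply: eq_bigr => y _; rewrite mulr_sumr; apply: eq_bigr => z _.
by do 2!case: (_ \in L); rewrite ?(mulr1, mulr0, mul0r) // mulrC.
Qed.

End Field.

Definition nb_at i x y : nat := #|[set z | e y z & d x z == i]|.

Lemma nb_at_const i x y x' y' : d x y = d x' y' -> nb_at i x y = nb_at i x' y'.
Proof.
move=> dd; have [cE bE] := proj2 e_dr x y x' y' dd.
have kE := deg_regular e_irr e_dr y y'.
have bnb u v : b_num e u v = nb_at (d u v).+1 u v by [].
have cnb u v : c_num e u v = nb_at (d u v).-1 u v by [].
have near u v : nb_at i u v != 0%N -> [|| i == (d u v).+1, i == d u v | i.+1 == d u v].
  rewrite -lt0n => /card_gt0P[z]; rewrite inE => /andP[ez /eqP <-].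
  have [] := gdist_step e_sym e_conn u ez; lia.
have part u v : (0 < d u v)%N ->
   deg e v = (nb_at (d u v).-1 u v + (nb_at (d u v) u v + nb_at (d u v).+1 u v))%N.
  move=> duv; rewrite /deg /nbhd -(cardsID [set z | d u z == (d u v).-1]); congr (_ + _)%N.
    by apply: eq_card => z; rewrite !inE.
  rewrite -(cardsID [set z | d u z == d u v]); congr (_ + _)%N; apply: eq_card => z; rewrite !inE.
    by case: (e v z) => //=; rewrite ?andbF //; lia.
  case: (boolP (e v z)) => ez; rewrite ?andbF //=.
  by have [] := gdist_step e_sym e_conn u ez; lia.
have zero u v : d u v = 0%N -> nb_at 0 u v = 0%N.
  move=> /eqP; rewrite (gdist_eq0 e_conn) => /eqP <-.
  apply/eqP; rewrite cards_eq0; apply/eqP/setP => z; rewrite !inE (gdist_eq0 e_conn) eq_sym.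
  by case: eqP => [->|]; rewrite ?andbF // e_irr.
have [iE|ni] := eqVneq i (d x y).+1; first by rewrite iE -bnb {1}dd -bnb in bE *.
have [iE|ni'] := eqVneq i.+1 (d x y).
  by move: cE; rewrite !cnb -dd -iE.
have [iE|ni''] := eqVneq i (d x y); last first.
  have [|n1] := eqVneq (nb_at i x y) 0%N; last by have := near x y n1; lia.
  by have [->|n2 ->] := eqVneq (nb_at i x' y') 0%N; last by have := near x' y' n2; lia.
rewrite iE; have [d0|d0] := posnP (d x y).
  by rewrite d0 !zero // -dd.
have := part x y d0; rewrite dd in d0; have := part x' y' d0.
rewrite -!bnb -!cnb -!dd; lia.
Qed.

(** * Matrices whose entries depend only on the distance, and equality of line sizes *)

Section Radial.

Lemma farthest (x : T) : exists x0 y0, forall x y, (d x y <= d x0 y0)%N.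
Proof.
case: (arg_maxnP (P := predT) (fun p : T * T => d p.1 p.2) (i0 := (x, x)) isT) => -[x0 y0] _ h.
by exists x0, y0 => a b; apply: (h (a, b)).
Qed.

Variables (x0 y0 : T).
Hypothesis far : forall x y, (d x y <= d x0 y0)%N.
Notation D := (d x0 y0).

(** Right multiplication by [A + s I] on matrices whose entries depend only on the distance. *)
Definition quotient_mx : 'M[rat]_D.+1 :=
  \matrix_(i, j) ((nb_at i x0 (at_dist e x0 j))%:R + s%:R * (i == j)%:R).

Definition radial (f : 'rV[rat]_D.+1) x y := f 0 (inord (d x y)).

Lemma radial_mul f x y :
  \sum_z radial f x z * ((e z y)%:R + s%:R * (z == y)%:R) = radial (f *m quotient_mx) x y.
Proof.
rewrite /radial mxE (partition_big (fun z => inord (d x z) : 'I_D.+1) predT) //=.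
apply: eq_bigr => i _; rewrite mxE.
rewrite (eq_bigr (fun z => f 0 i * ((e z y)%:R + s%:R * (z == y)%:R))); last first.
  by move=> z /eqP ->.
rewrite -mulr_sumr big_split /=; congr (_ * (_ + _)).
  have le : (inord (d x y) : 'I_D.+1) = d x y :> nat by rewrite inordK // ltnS.
  rewrite (@nb_at_const _ _ _ x y); last first.
    by rewrite (at_distP (y0 := y0) e_sym e_dr) le.
  rewrite /nb_at -sum1_card natr_sum big_mkcond [RHS]big_mkcond /=; apply: eq_bigr => z _.
  rewrite inE e_sym -val_eqE /= inordK ?ltnS //.
  by case: (e y z); case: (d x z == i).
rewrite -mulr_sumr; congr (_ * _); rewrite big_mkcond (bigD1 y) //= eqxx big1 ?addr0 => [|z zy].
  by rewrite eq_sym; case: eqP.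
by rewrite (negbTE zy) if_same.
Qed.

(** If [quotient_mx] were invertible, the identity would be a multiple of [A + s I]. *)
Lemma radial_kernel : exists2 f : 'rV_D.+1, f != 0 & f *m quotient_mx = 0.
Proof.
have [U|] := boolP (quotient_mx \in unitmx); last first.
  rewrite -row_free_unit -kermx_eq0 => /rowV0Pn[f fK f0]; exists f => //.
  exact/sub_kermxP.
exfalso; have [v [x vx] vL] := incidence_kernel rat; move/eqP: vx; apply.
(* The matrix [radial f] times [A + s I] is the identity, so pairing with the kernel vector [v]
   gives [v x = 0]. *)
pose f : 'rV_D.+1 := delta_mx 0 ord0 *m invmx quotient_mx.
have := incidence_form (radial f x) v.
rewrite [RHS]big1 => [|L LC]; last by rewrite (vL L LC) mulr0.
rewrite (eq_bigr (fun y => v y * (y == x)%:R)) => [|y _].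
  rewrite (bigD1 x) //= eqxx mulr1 big1 ?addr0 // => y /negbTE ->; exact: mulr0.
rewrite radial_mul /f mulmxKV // /radial mxE eqxx /=; congr (_ * _%:R).
by rewrite -val_eqE /= inordK ?ltnS // (gdist_eq0 e_conn) eq_sym.
Qed.

(** With [E N N^T E^T = 0] over [rat], the sum of squares of the entries of [E N] vanishes. *)
Lemma radial_line f L x : f *m quotient_mx = 0 -> L \in CC -> \sum_(z in L) radial f x z = 0.
Proof.
move=> f0 LC; have := incidence_form (radial f x) (radial f x).
rewrite [LHS]big1 => [/esym/eqP|y _]; last by rewrite radial_mul f0 /radial mxE mulr0.
rewrite psumr_eq0 => [|M _]; last by rewrite -expr2 sqr_ge0.
by move/allP/(_ L); rewrite mem_index_enum LC -expr2 sqrf_eq0 => /(_ isT)/eqP.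
Qed.

(** [f *m quotient_mx = 0] is a three-term recurrence in which the last coefficient is some
    [b_i > 0], so the first two entries determine [f]. *)
Lemma radial_head f : f *m quotient_mx = 0 -> radial f x0 x0 = 0 ->
  (forall y, e x0 y -> radial f x0 y = 0) -> f = 0.
Proof.
move=> fq f0 f1.
have rad z : radial f x0 z = f 0 (inord (d x0 z)) by [].
suff H l : (l <= D)%N -> f 0 (inord l) = 0.
  by apply/rowP => i; rewrite mxE -(inord_val i) H // -ltnS.
elim/ltn_ind: l => l IH le; have dl := at_distP e_sym e_dr le.
case: l IH le dl => [|[|l]] IH le dl.
- by move: f0; rewrite rad gdistxx.
- by have := f1 (at_dist e x0 1); rewrite rad dl -(gdist_eq1 e_conn e_irr) dl eqxx => ->.
have dl' := at_distP e_sym e_dr (ltnW le).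
set y := at_dist e x0 l.+1 in dl'.
have := radial_mul f x0 y; rewrite fq /radial mxE.
rewrite (eq_bigr (fun z => f 0 (inord l.+2) * ((e y z) && (d x0 z == l.+2))%:R)) => [|z _].
  rewrite -mulr_sumr => /eqP; rewrite mulf_eq0 => /orP[/eqP //|].
  have [|z ez dz] := b_num_gt0 e_sym e_dr (x0 := x0) (y0 := y0) (x := x0) (y := y).
    by rewrite dl'.
  rewrite dl' in dz; rewrite (bigD1 z) //= ez dz eqxx /= => /eqP h; exfalso.
  suff : (0 : rat) < 0 by rewrite ltxx.
  rewrite -{2}h ltr_pwDl //; apply: sumr_ge0 => w _; exact: ler0n.
have [dz|dz] := ltnP (d x0 z) l.+2.
  rewrite (IH (d x0 z) dz (far _ _)) mul0r; have -> : (d x0 z == l.+2) = false by lia.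
  by rewrite andbF mulr0.
have -> : (z == y) = false by apply/negP => /eqP zy; rewrite zy dl' ltnn in dz.
rewrite mulr0 addr0 e_sym; case: (boolP (e y z)) => eyz; rewrite ?mulr0 //= mulr1.
have dz2 : d x0 z = l.+2 by have [] := gdist_step e_sym e_conn x0 eyz; lia.
by rewrite dz2 eqxx mulr1.
Qed.

(** Summing [radial f] over a line through the base point gives [f_0 + (|M| - 1) f_1 = 0] for every
    line [M]. Here [f_1] is nonzero, since otherwise [f_0] vanishes too and [radial_head] gives
    [f = 0]. *)
Lemma line_card_const L L' : L \in CC -> L' \in CC -> #|L| = #|L'|.
Proof.
have [f fn0 fq] := radial_kernel.
have e01 x y : e x y -> radial f x y = f 0 (inord 1).
  by move=> exy; rewrite /radial; have /eqP -> : d x y == 1%N; rewrite ?gdist_eq1.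
have main M : M \in CC -> f 0 ord0 + (#|M|.-1)%:R * f 0 (inord 1) = 0.
  move=> MC; have [x xM] : exists x, x \in M by apply/card_gt0P; apply: ltnW; apply: line_gt1.
  rewrite -(radial_line x fq MC) (bigD1 x) //=; congr (_ + _).
    by rewrite /radial gdistxx //; congr (f _ _); apply: val_inj; rewrite /= inordK.
  rewrite (eq_bigr (fun _ => f 0 (inord 1))) => [|y /andP[yM yx]].
    rewrite sumr_const mulr_natl; congr (_ *+ _).
    rewrite (cardsD1 x M) xM /=; apply: eq_card => y; rewrite !inE; exact: andbC.
  by apply: e01; apply: (line_cl MC) => //; rewrite eq_sym.
move=> LC LC'; have h := main _ LC; have h' := main _ LC'.
have [f1|f1] := eqVneq (f 0 (inord 1)) 0; last first.
  have := h; rewrite -[in RHS]h' => /addrI/(mulIf f1)/eqP; rewrite eqr_nat => /eqP.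
  have := line_gt1 LC; have := line_gt1 LC'; lia.
exfalso; move/eqP: fn0; apply; apply: (radial_head fq).
  rewrite f1 mulr0 addr0 in h; rewrite /radial gdistxx // -h; congr (f _ _).
  by apply: val_inj; rewrite /= inordK.
by move=> y /e01 ->.
Qed.

End Radial.

Lemma lines_eigenvalue : eigenvalue (adjmx e) (- s%:R).
Proof.
have [v [x vx] vL] := incidence_kernel algC.
pose w : 'rV[algC]_#|T| := \row_i v (enum_val i).
apply/eigenvalueP; exists w; last first.
  apply/eqP => /rowP/(_ (enum_rank x)); rewrite !mxE enum_rankK.
  by move/eqP; rewrite (negbTE vx).
apply/rowP => j; rewrite !mxE; set y := enum_val j.
have := incidence_form v (fun z => (z == y)%:R : algC).
rewrite [RHS]big1 => [|L LC]; last by rewrite (vL L LC) mul0r.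
rewrite (bigD1 y) //= eqxx mul1r [X in _ + X]big1 ?addr0 => [|z /negbTE ->]; last exact: mul0r.
rewrite (eq_bigr (fun z => v z * (e z y)%:R + v z * (s%:R * (z == y)%:R))) => [|z _]; last exact: mulrDr.
rewrite big_split /= => /eqP; rewrite addr_eq0 => /eqP h.
rewrite (reindex _ (onW_bij _ (@enum_rank_bij T))) /=.
rewrite (eq_bigr (fun z => v z * (e z y)%:R)) => [|z _]; last by rewrite !mxE enum_rankK.
rewrite h (bigD1 y) //= eqxx mulr1 big1 ?addr0 => [|z /negbTE ->]; last by rewrite !mulr0.
by rewrite mulNr mulrC.
Qed.

(** For an eigenvector [v] the form of [N N^T] is both [a + s] times the squared norm of [v] and a
    sum of squared moduli over the lines. *)
Lemma lines_eigenvalue_min a : eigenvalue (adjmx e) a -> - s%:R <= a.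
Proof.
case/eigenvalueP => w wA w0; pose v x := w 0 (enum_rank x).
have vA y : \sum_z v z * (e z y)%:R = a * v y.
  have := congr1 (fun A : 'rV_ _ => A 0 (enum_rank y)) wA; rewrite !mxE => <-.
  rewrite [RHS](reindex _ (onW_bij _ (@enum_rank_bij T))) /=; apply: eq_bigr => z _.
  by rewrite !mxE !enum_rankK.
have := incidence_form v (fun z => (v z)^*).
rewrite (eq_bigr (fun y => (a + s%:R) * `|v y| ^+ 2)) => [|y _]; last first.
  rewrite (eq_bigr (fun z => v z * (e z y)%:R + v z * (s%:R * (z == y)%:R))) => [|z _]; last exact: mulrDr.
  rewrite big_split /= vA (bigD1 y) //= eqxx mulr1 big1 ?addr0 => [|z /negbTE ->]; last by rewrite !mulr0.
  by rewrite normCK; ring.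
rewrite -mulr_sumr => h.
have pos : 0 < \sum_y `|v y| ^+ 2.
  rewrite lt_def sumr_ge0 ?andbT => [|y _]; last by rewrite exprn_ge0.
  apply: contra w0; rewrite psumr_eq0 => [/allP v0|y _]; last by rewrite exprn_ge0.
  apply/eqP/rowP => i; rewrite mxE; have := v0 (enum_val i); rewrite mem_index_enum => /(_ isT).
  by rewrite expf_eq0 normr_eq0 /v enum_valK => /eqP.
have : 0 <= (a + s%:R) * \sum_y `|v y| ^+ 2.
  rewrite h; apply: sumr_ge0 => L _; rewrite -rmorph_sum /= -normCK; exact: exprn_ge0.
by rewrite pmulr_lge0 // -lerBlDr sub0r.
Qed.

(** The smallest eigenvalue is [- s], and lines of equal size give [k = s (|L| - 1)]. *)
Lemma geometric_of_lines : ~ complete_graph e -> geometric e.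
Proof.
move=> nc; split=> //; exists (- s%:R); split.
  by split; [exact: lines_eigenvalue | exact: lines_eigenvalue_min].
exists CC; split; last exact: line1.
move=> L LC; split; first exact: line_cl.
have [x0 xL] : exists x, x \in L by apply/card_gt0P; apply: ltnW; apply: line_gt1.
have [a [b far]] := farthest x0.
have s0 : (0 < s)%N by rewrite -(linesE x0); apply/card_gt0P; exists L; rewrite inE LC.
move=> x; rewrite degE -(sum_lines x) (eq_bigr (fun _ => #|L|.-1)) => [|M]; last first.
  by rewrite inE => /andP[MC _]; rewrite (line_card_const far MC LC).
rewrite sum_nat_const linesE opprK natrM mulrAC mulfV ?mul1r ?pnatr_eq0 -?lt0n //.
by rewrite -[in LHS](prednK (ltnW (line_gt1 LC))) mulrSr addrC.
Qed.

End Delsarte.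

(** * Combining the three cases into a bound on the order *)

Section OrderBound.
Variable m : nat.
Hypothesis hm : 2 <= m.

Let q := m ^ 2.
Let r := q.+1.
(** If [c_2 >= c] the order is bounded; otherwise a valency above [k0] makes the graph geometric. *)
Let c := 2 ^ (r ^ 4 + 2 * r ^ 3 + 2 * r ^ 2 + 2 + r).
Let k0 := q * (2 * q.+1 * q.+1 * c.+1).

Lemma order_bound (T : finType) (e : rel T) :
  simple_graph e -> distance_regular e -> ~ complete_graph e -> coconnected e -> ~ geometric e ->
  (forall a : algC, eigenvalue (adjmx e) a -> - (m%:R) <= a)%R ->
  (forall x y : T, gdist e x y = 2 -> 2 <= c_num e x y) ->
  #|T| <= 1 + r ^ 2 + r ^ 2 * r ^ 2 + k0.+1 ^ 2 ^ k0.*2.+1.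
Proof.
case=> e_sym e_irr e_dr nc co ng ge_m mu2; have e_conn := proj1 e_dr.
have m0 : 0 < m by apply: ltnW.
have claw x (Y : {set T}) : Y \subset nbhd e x -> coclique e Y -> #|Y| <= q.
  exact: (claw_free e_sym e_irr m0 ge_m).
have cone := clique_coneighbours e_sym e_irr m0 ge_m.
have r1 : 1 < r by rewrite ltnS expn_gt0 m0.
have [x1 [y1 d1]] := not_complete_dist2 e_sym e_irr e_dr nc.
have muE x y : gdist e x y = 2 -> #|common e x y| = #|common e x1 y1|.
  move=> dxy; rewrite -!(c_num2 e_irr e_dr) //.
  by apply: (proj1 (proj2 e_dr _ _ _ _ _)); rewrite dxy.
have [big|small] := leqP c #|common e x1 y1|.
  apply: leq_trans (leq_addr _ _); apply: (card_dense e_sym e_irr e_dr co nc).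
    move=> x; apply: ltnW; apply: (card_large_common_lt e_sym e_irr r1 claw cone (x := x)) => z.
    rewrite inE => /eqP dz; split; last by rewrite -/(common e x z) muE.
      by apply/eqP => zx; rewrite zx gdistxx in dz.
    by rewrite -(gdist_eq1 e_conn e_irr) dz.
  move=> x y /muE ->; apply: leq_trans big; apply: leq_trans (ltn_expl _ (ltnSn 1)); lia.
apply: leq_trans (leq_addl _ _); apply: (card_bound e_sym e_irr e_dr mu2).
have [v evy _] := gdist_pred e_sym e_conn d1.
have lamE x y : e x y -> #|common e x y| = #|common e v y1|.
  by move=> exy; apply: (card_common_regular e_sym e_irr e_dr).
have degE x : deg e x = deg e v by apply: deg_regular.
move=> x; rewrite degE; apply: leq_trans (valency_le e_sym e_irr lamE claw degE x) _.
(* A valency above [k0] would force [lam] past the threshold [lam_big], and the lines would make the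
   graph geometric. *)
rewrite leq_mul2l ltnNge; apply/orP; right; apply/negP => lam_big; apply: ng.
have mu_le a b : a != b -> ~~ e a b -> #|common e a b| <= c.
  move=> ab eab; have [->|] := eqVneq (common e a b) set0; first by rewrite cards0.
  case/set0Pn => z; rewrite !inE => /andP[eaz ebz].
  by rewrite muE ?(ltnW small) // (gdist_eq2 e_irr e_dr ab eab eaz) // e_sym.
have T0 : 0 < #|T| by apply/card_gt0P; exists x.
pose L := lines e #|common e v y1| c q.
apply: (@geometric_of_lines T e L #|lines_at e #|common e v y1| c q x| (deg e v)) => //.
- by move=> M; apply: line_clique.
- by move=> a b; apply: (one_line e_sym e_irr lamE mu_le claw lam_big).
- move=> a; exact: (lines_at_const e_sym e_irr lamE mu_le claw degE lam_big).
- exact: (card_lines_lt e_sym e_irr lamE mu_le claw degE lam_big).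
- move=> M /(line_card lamE lam_big)/andP[h _]; apply: leq_trans h.
  by move: lam_big; clear; nia.
by move=> a; exact: (sum_lines_at e_sym e_irr lamE mu_le claw degE lam_big).
Qed.

Lemma order_bounded : exists n, forall (T : finType) (e : rel T),
  simple_graph e -> distance_regular e -> ~ complete_graph e -> coconnected e -> ~ geometric e ->
  (forall a : algC, eigenvalue (adjmx e) a -> - (m%:R) <= a)%R ->
  (forall x y : T, gdist e x y = 2 -> 2 <= c_num e x y) -> #|T| <= n.
Proof. by eexists => T e; apply: order_bound. Qed.

End OrderBound.

(** Adjacency functions on ['I_i] with [i <= n] form a finite type, whose enumeration serves as the
    list. *)
Lemma finitely_many_graphs n : exists (N : nat) (G : 'I_N -> {n : nat & rel 'I_n}),
  forall (T : finType) (e : rel T), #|T| <= n -> exists i : 'I_N, graph_iso e (projT2 (G i)).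
Proof.
pose X := {i : 'I_n.+1 & {ffun 'I_i * 'I_i -> bool}}.
pose g (x : X) : {n : nat & rel 'I_n} :=
  existT (fun n => rel 'I_n) (tag x : nat) (fun a b => tagged x (a, b)).
exists #|{: X}|, (fun i => g (enum_val i)) => T e le.
have lt : #|T| < n.+1 by [].
pose x : X := @Tagged _ (Ordinal lt) (fun i : 'I_n.+1 => {ffun 'I_i * 'I_i -> bool})
  [ffun p => e (enum_val p.1) (enum_val p.2)].
exists (enum_rank x); rewrite enum_rankK; exists (@enum_rank T); split.
  exact: enum_rank_bij.
by move=> a b; rewrite /= ffunE !enum_rankK.
Qed.

Theorem theorem1p3 (m : nat) (hm : 2 <= m) :
  exists (N : nat) (G : 'I_N -> {n : nat & rel 'I_n}),
    forall (T : finType) (e : rel T),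
      simple_graph e ->
      distance_regular e ->
      ~ complete_graph e ->
      coconnected e ->
      ~ geometric e ->
      (forall a : algC, eigenvalue (adjmx e) a -> - (m%:R) <= a)%R ->
      (forall x y : T, gdist e x y = 2 -> 2 <= c_num e x y) ->
      exists i : 'I_N, graph_iso e (projT2 (G i)).
Proof.
have [n ord] := order_bounded hm; have [N [G GP]] := finitely_many_graphs n.
by exists N, G => T e es dr nc co ng ge mu; apply: GP; apply: (ord T e).
Qed.
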